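(* For every $n\ge 3$, all roots of the genus polynomial $\Gamma_{W_n}(x)$ of the wheel graph $W_n$ are negative real numbers. Consequently, the genus distribution $g_0(W_n),g_1(W_n),g_2(W_n),\dots$ of $W_n$ is log-concave and unimodal.
   Context: The wheel graph $W_n$ ($n\ge3$) is obtained from the cycle $C_n$ by adding one new vertex and joining it to all vertices of $C_n$. Genus polynomial: surfaces are closed orientable; $\mathbb{S}_k$ is the orientable surface of genus $k$. An embedding of a connected graph $G$ on a surface $S$ is a homeomorphism $h$ of $G$ onto a subset $h(G)$ of $S$ such that every component of $S-h(G)$ is a 2-cell. Two embeddings $h,g:G\to S$ are equivalent if there is an orientation-preserving homeomorphism $f:S\to S$ with $f\circ h=g$. Let $g_k(G)$ be the number of equivalence classes of embeddings of $G$ on $\mathbb{S}_k$; the sequence $g_0(G),g_1(G),\dots$ is the genus distribution of $G$, and $\Gamma_G(x)=\sum_{k\ge0}g_k(G)x^k$ is its genus polynomial. Equivalently (standard fact), $g_k(G)$ is the number of rotation systems of the labelled graph $G$ (a choice, at each vertex, of a cyclic permutation of the edge-ends at that vertex) whose face count $f$ obtained by face tracing satisfies $|V(G)|-|E(G)|+f=2-2k$. A sequence $a_0,\dots,a_N$ of nonnegative reals is log-concave if $a_k^2\ge a_{k-1}a_{k+1}$ for $1\le k\le N-1$, and unimodal if for some $0\le j\le N$, $a_0\le a_1\le\cdots\le a_j\ge a_{j+1}\ge\cdots\ge a_N$. *)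

(* Defs.v *)
From HB Require Import structures.
From mathcomp Require Import all_boot all_order all_algebra all_fingroup zify.

Set Implicit Arguments.
Unset Strict Implicit.
Unset Printing Implicit Defensive.

Import Order.TTheory GRing.Theory Num.Theory.

Record sgraph := SGraph {
  svertex :> finType;
  adj : rel svertex;
  adj_sym : symmetric adj;
  adj_irrefl : irreflexive adj
}.

Definition edges (G : sgraph) : {set {set G}} :=
  [set [set p.1; p.2] | p in [pred p : G * G | adj p.1 p.2]].

(* The dart (u, v) is the end at u of the edge uv. *)
Definition dart (G : sgraph) := {p : G * G | adj p.1 p.2}.

Definition tail (G : sgraph) (d : dart G) : G := (val d).1.

Lemma drev_subproof (G : sgraph) (d : dart G) :
  adj ((val d).2, (val d).1).1 ((val d).2, (val d).1).2.
Proof. by rewrite /= adj_sym (valP d). Qed.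

Definition drev (G : sgraph) (d : dart G) : dart G :=
  exist _ ((val d).2, (val d).1) (drev_subproof d).

Lemma drevK (G : sgraph) : involutive (@drev G).
Proof. by case=> [[u v] uv]; apply/val_inj. Qed.

Definition drev_perm (G : sgraph) : {perm dart G} := perm (inv_inj (@drevK G)).

(* A choice of a cyclic permutation of the edge-ends at each vertex is encoded
   as one permutation of all the darts, whose cycles are exactly the sets of
   darts with a common tail. *)
Definition is_rotation_system (G : sgraph) (rho : {perm dart G}) : bool :=
  [forall d : dart G, porbit rho d == [set d' | tail d' == tail d]].

(* Face tracing: traverse d, then leave its head along the dart that follows
   the reverse of d in the rotation; the product of permutations applies its
   left factor first. *)
Definition face_perm (G : sgraph) (rho : {perm dart G}) : {perm dart G} :=
  (drev_perm G * rho)%g.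

Definition face_count (G : sgraph) (rho : {perm dart G}) : nat :=
  #|porbits (face_perm rho)|.

(* The number g_k(G) of embeddings of G on the orientable surface of genus k,
   for G connected with at least one edge: as faces are orbits of darts, the
   single face of the one-vertex graph is not counted. *)
Definition genus_dist (G : sgraph) (k : nat) : nat :=
  #|[set rho : {perm dart G} | is_rotation_system rho &
      (#|G|%:Z - #|edges G|%:Z + (face_count rho)%:Z == 2 - 2 * k%:Z)%R]|.

(* The bound on k loses no term: see [coef_genus_poly]. *)
Definition genus_poly (G : sgraph) : {poly int} :=
  (\poly_(k < #|edges G|.+2) (genus_dist G k)%:Z)%R.

Lemma coef_genus_poly (G : sgraph) (k : nat) :
  ((genus_poly G)`_k = (genus_dist G k)%:Z)%R.
Proof.
rewrite coef_poly; case: ltnP => // le_Ek.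
rewrite /genus_dist (_ : [set _ | _] = set0) ?cards0 //.
apply/setP=> rho; rewrite !inE; apply/negbTE/negP=> /andP[_ /eqP Euler].
by move: le_Ek Euler; move: #|G| #|edges G| (face_count rho) => V E F; lia.
Qed.

Section Cycle.
Variable n : nat.

(* The condition i != j only matters in the degenerate case n = 1. *)
Definition cycle_adj : rel 'I_n :=
  [rel i j | (i != j) && ((j == ordS i) || (i == ordS j))].

Lemma cycle_adj_sym : symmetric cycle_adj.
Proof. by move=> i j; rewrite /cycle_adj /= eq_sym orbC. Qed.

Lemma cycle_adj_irrefl : irreflexive cycle_adj.
Proof. by move=> i; rewrite /cycle_adj /= eqxx. Qed.

Definition cycle_graph : sgraph := SGraph cycle_adj_sym cycle_adj_irrefl.
End Cycle.

Section Cone.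
Variable G : sgraph.

Definition cone_adj : rel (option G) :=
  [rel x y | match x, y with
             | Some u, Some v => adj u v
             | None, None => false
             | _, _ => true
             end].

Lemma cone_adj_sym : symmetric cone_adj.
Proof. by move=> [u|] [v|] //=; apply: adj_sym. Qed.

Lemma cone_adj_irrefl : irreflexive cone_adj.
Proof. by move=> [u|] //=; apply: adj_irrefl. Qed.

Definition cone : sgraph := SGraph cone_adj_sym cone_adj_irrefl.
End Cone.

Definition wheel (n : nat) : sgraph := cone (cycle_graph n).

Definition log_concave (N : nat) (a : nat -> nat) : Prop :=
  forall k, 0 < k < N -> a k.-1 * a k.+1 <= a k ^ 2.

Definition unimodal (N : nat) (a : nat -> nat) : Prop :=
  exists2 j, j <= N &
    (forall k, k < j -> a k <= a k.+1) /\
    (forall k, j <= k < N -> a k.+1 <= a k).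

(* Main.v *)
Require Import Defs.
From HB Require Import structures.
From mathcomp Require Import all_boot all_order all_algebra all_fingroup.
From mathcomp Require Import algC zify ring.

Import Order.TTheory GRing.Theory Num.Theory.

(** Let F(x) be the sum of x^f over the rotation systems of the wheel with n rim
    vertices, where f is the number of faces. By Euler's formula
    F(x) = x^(n+1) Gamma(x^-2) [face_poly_genus_poly], so a root z <> 0 of the
    genus polynomial Gamma gives two opposite zeros of F, the square roots of
    1/z. Hence it is enough that F has no zero with positive real part
    [face_poly_neq0] and that the wheel is planar, so that 0 is not a root
    [genus_dist0_gt0].

    A rotation system of the wheel amounts to a set S of rim vertices, those with
    one of the two possible rotations, and a cyclic permutation u of the n darts
    at the hub [rotation_system_spin]. Erasing the rotation at the hub leaves two
    boundary walks along the rim, one with the spokes of S attached to it and one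
    with the other spokes. So the faces are the cycles of u w for a permutation w
    with only two cycles, which contain |S| and n - |S| of the darts at the hub.

    The sum over u is given by a formula of Stanley [stanley_formula]. Let E be
    the backward shift, which sends f to x |-> f(x - 1). If w is any permutation
    and A a nonempty set of N points, then the sum over the cyclic permutations u
    of A of x^(number of cycles of u w), times N (N + 1), is x^z times the product
    of the operators 1 - E^k applied to x (x + 1) ... (x + N); here k runs over
    the numbers of points of A on the cycles of w that meet A, and z is the number
    of the other cycles. The proof is by induction: removing a point of A from u
    multiplies w by a transposition, which cuts or joins cycles of w, and the
    right-hand side satisfies the same recurrence [stanley_rec].

    Summing over S, n (n + 1) F(x) is the value at x of g(E) applied to
    x (x + 1) ... (x + n), where
      g(t) = sum_S (1 - t^|S|) (1 - t^(n - |S|)) + 2 x (1 - t^n)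
    [face_poly_umbral]. If Re x > 0, then g has no zero in the open unit disc,
    because (1 - a) (1 - b) / (1 - a b) has nonnegative real part for a and b in
    the disc [sum_mobius_neq0]. So g(E) is a product of factors E - r with
    |r| >= 1, and such factors move zeros to the right so slowly that at most n of
    them cannot produce a zero in the half-plane Re > 0 [umbral_rising_neq0].

    Log-concavity and unimodality hold for the coefficients of every polynomial
    with a nonnegative leading coefficient and negative roots only, as
    multiplication by X - z with z < 0 preserves a strong form of log-concavity
    [log_concave_prod_XsubC]. *)

Set Implicit Arguments.
Unset Strict Implicit.
Unset Printing Implicit Defensive.

(** * A linear functional on polynomials *)

Section Umbral.
Local Open Scope ring_scope.

Definition rising (R : comNzRingType) (n : nat) (x : R) : R :=
  \prod_(i < n) (x + i%:R).

(** The value at x of p(E) f, where E is the backward shift of functions,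
    which sends f to the function x |-> f (x - 1). *)
Definition umbral (R : comNzRingType) (f : R -> R) (x : R) (p : {poly R}) : R :=
  \sum_(k < size p) p`_k * f (x - k%:R).

Section UmbralTheory.
Variables (R : comNzRingType) (f : R -> R) (x : R).
Implicit Types p q : {poly R}.

Lemma umbral_widen N p : (size p <= N)%N ->
  umbral f x p = \sum_(k < N) p`_k * f (x - k%:R).
Proof.
move=> le_pN; rewrite /umbral (big_ord_widen _ (fun k => p`_k * f (x - k%:R)) le_pN).
rewrite big_mkcond; apply: eq_bigr => k _; case: ltnP => // le_pk.
by rewrite nth_default // mul0r.
Qed.

Lemma umbral_is_linear : linear_for *%R (umbral f x).
Proof.
move=> c p q; set N := maxn (size p) (size q).
rewrite (@umbral_widen N (c *: p + q)); last first.
  rewrite (leq_trans (size_polyD _ _)) // geq_max leq_maxr andbT.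
  by rewrite (leq_trans (size_scale_leq _ _)) ?leq_maxl.
rewrite (@umbral_widen N p) ?leq_maxl // (@umbral_widen N q) ?leq_maxr //.
rewrite mulr_sumr -big_split; apply: eq_bigr => k _.
by rewrite coefD coefZ mulrDl mulrA.
Qed.

HB.instance Definition _ :=
  GRing.isLinear.Build R {poly R} R *%R (umbral f x) umbral_is_linear.

Lemma umbralXn k : umbral f x 'X^k = f (x - k%:R).
Proof.
rewrite /umbral size_polyXn big_ord_recr big1 /= => [|i _].
  by rewrite coefXn eqxx mul1r add0r.
by rewrite coefXn ltn_eqF ?mul0r //=.
Qed.

End UmbralTheory.

Lemma umbralMX (R : comNzRingType) (f : R -> R) x (p : {poly R}) :
  umbral f x (p * 'X) = umbral f (x - 1) p.
Proof.
rewrite -[p]coefK poly_def mulr_suml !linear_sum; apply: eq_bigr => k _.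
by rewrite -scalerAl -exprSr !linearZ /= !umbralXn -addn1 natrD opprD addrA addrAC.
Qed.

Lemma risingS (R : comNzRingType) n (x : R) :
  rising n.+1 x = rising n x * (x + n%:R).
Proof. by rewrite /rising big_ord_recr. Qed.

Lemma risingSl (R : comNzRingType) n (x : R) :
  rising n.+1 (x - 1) = (x - 1) * rising n x.
Proof.
rewrite /rising big_ord_recl addr0; congr (_ * _); apply: eq_bigr => i _.
by rewrite /= /bump /= natrD addrA subrK.
Qed.

End Umbral.

(** * Zeros in the right half-plane *)

Section HalfPlane.
Local Open Scope ring_scope.
Variable C : numClosedFieldType.
Implicit Types x y z r : C.

Lemma normCK_sub (c z : C) : c \is Num.real ->
  `|z| ^+ 2 - `|z - c| ^+ 2 = 2 * c * ('Re z - c / 2).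
Proof. by move=> cR; rewrite !normCK rmorphB /= (CrealP cR) ReE; field. Qed.

Lemma ler_norm_sub (c z : C) : 0 <= c -> c / 2 <= 'Re z -> `|z - c| <= `|z|.
Proof.
move=> c0 hz; rewrite -(ler_pXn2r (_ : 0 < 2)%N) ?nnegrE // -subr_ge0.
by rewrite normCK_sub ?ger0_real // !mulr_ge0 ?subr_ge0.
Qed.

Lemma ltr_norm_sub (c z : C) : 0 < c -> c / 2 < 'Re z -> `|z - c| < `|z|.
Proof.
move=> c0 hz; rewrite -(ltr_pXn2r (_ : 0 < 2)%N) ?nnegrE // -subr_gt0.
by rewrite normCK_sub ?gtr0_real // !mulr_gt0 ?subr_gt0.
Qed.

Lemma ler_norm_prod_shift (zs : seq C) (a : C) x :
    {in zs, forall z, 'Re z <= a} -> a + 2^-1 <= 'Re x ->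
  `|\prod_(z <- zs) (x - 1 - z)| <= `|\prod_(z <- zs) (x - z)|.
Proof.
move=> le_zs_a le_a_x; rewrite !normr_prod big_seq [leRHS]big_seq.
apply: ler_prod => z /le_zs_a le_z_a; rewrite normr_ge0 addrAC.
rewrite ler_norm_sub // raddfB /= mul1r lerBrDl (le_trans _ le_a_x) //.
by rewrite lerD2r.
Qed.

(** The zeros of a polynomial obtained by applying factors E - r with
    |r| >= 1 to x (x + 1) ... (x + n), where E is the backward shift, drift
    to the right by at most 1/2 per factor. Indeed, if the zeros of P have
    real part at most a and a + 1/2 < Re x, then |P (x - 1)| < |P x|, so that
    P (x - 1) - r P x is not 0. Applied bluntly to the zeros 0, -1, ..., -n
    this loses n/2 in the end; but each factor keeps all of the product
    x (x + 1) ... except its last term, and the remaining factor Q has zeros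
    of real part at most -N/2 only, where N is the number of factors E - r
    that could still be applied. *)
Lemma umbral_rising_prod n N (rs : seq C) :
    all (fun r => 1 <= `|r|) rs -> (size rs + N = n)%N ->
  exists zs : seq C, exists2 c : C, c != 0 &
    {in zs, forall z, 'Re z <= - (N%:R / 2)} /\
    forall x, umbral (rising n.+1) x (\prod_(r <- rs) ('X - r%:P)) =
              rising N.+1 x * (c * \prod_(z <- zs) (x - z)).
Proof.
elim: rs N => [|r rs IHrs] N /=.
  rewrite add0n => _ ->; exists [::], 1; rewrite ?oner_eq0 //; split=> // x.
  by rewrite !big_nil -[1 in LHS]/(('X ^+ 0)) umbralXn subr0 !mulr1.
case/andP=> r1 rs1 sz; have{IHrs} := IHrs N.+1 rs1.
rewrite addnS => /(_ sz)[zs [c c0 [le_zs umbE]]].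
pose Q := \prod_(z <- zs) ('X - z%:P).
have QE x : Q.[x] = \prod_(z <- zs) (x - z).
  by rewrite horner_prod; apply: eq_bigr => z _; rewrite hornerXsubC.
pose Q' := ('X - 1) * (Q \Po ('X - 1)) - r *: (('X + N.+1%:R%:P) * Q).
have Q'E x : Q'.[x] = (x - 1) * Q.[x - 1] - r * ((x + N.+1%:R) * Q.[x]).
  by rewrite /Q' !hornerE horner_comp !hornerE.
(* The points 1 and -(N + 1) have the line Re x = -N/2 as bisector, so
   the linear factors of Q' contribute a strict inequality of norms. *)
have Q'nz x : - (N%:R / 2) < 'Re x -> Q'.[x] != 0.
  move=> hx; rewrite Q'E subr_eq0; apply/eqP => /(congr1 Num.norm) /eqP.
  rewrite lt_eqF // !normrM.
  have Qx : 0 < `|Q.[x]|.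
    rewrite normr_gt0 QE prodf_seq_neq0; apply/allP=> z /le_zs hz; apply/implyP=> _.
    rewrite subr_eq0; apply: contraTneq hx => ->; rewrite -real_leNgt ?Creal_Re //; last first.
      by rewrite rpredN rpredM ?rpredV ?rpred_nat.
    apply: le_trans hz _; rewrite lerN2 ler_pM2r ?invr_gt0 ?ltr0n //.
    by rewrite ler_nat.
  have ltx : `|x - 1| < `|x + N.+1%:R|.
    have -> : x - 1 = (x + N.+1%:R) - N.+2%:R by rewrite -[N.+2]addn1 natrD; ring.
    apply: ltr_norm_sub; rewrite ?ltr0n // raddfD /= (Creal_ReP N.+1%:R _) ?rpred_nat //.
    rewrite -subr_gt0; rewrite -subr_gt0 in hx; apply: lt_le_trans hx _.
    rewrite le_eqVlt; apply/orP; left; apply/eqP.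
    by rewrite -(@natr1 _ N.+1) -(@natr1 _ N); field.
  have leQ : `|Q.[x - 1]| <= `|Q.[x]|.
    rewrite !QE; apply: ler_norm_prod_shift le_zs _.
    apply: le_trans (ltW hx); rewrite le_eqVlt; apply/orP; left; apply/eqP.
    by rewrite -(@natr1 _ N); field.
  apply: (@lt_le_trans _ _ (`|x + N.+1%:R| * `|Q.[x]|)).
    apply: le_lt_trans (ler_wpM2l (normr_ge0 _) leQ) _.
    by rewrite ltr_pM2r.
  by rewrite ler_peMl // mulr_ge0.
have Q'0 : Q' != 0.
  apply: contraNneq (Q'nz 1 _) => [->|]; first by rewrite horner0.
  rewrite (Creal_ReP _ _) ?rpred1 // (@le_lt_trans _ _ 0) ?ltr01 // oppr_le0.
  by rewrite mulr_ge0 ?invr_ge0 ?ler0n.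
have [zs' defQ'] := closed_field_poly_normal Q'.
exists zs', (c * lead_coef Q'); first by rewrite mulf_neq0 ?lead_coef_eq0.
split=> [z zs'z|x].
  have : root Q' z by rewrite defQ' rootZ ?lead_coef_eq0 // root_prod_XsubC.
  rewrite real_leNgt ?Creal_Re //; last by rewrite rpredN rpredM ?rpredV ?rpred_nat.
  by move=> rz; apply/negP=> /Q'nz; rewrite -rootE rz.
have -> : c * lead_coef Q' * \prod_(z <- zs') (x - z) = c * Q'.[x].
  rewrite {2}defQ' hornerZ horner_prod mulrA; congr (_ * _).
  by apply: eq_bigr => z _; rewrite hornerXsubC.
rewrite big_cons mulrC mulrBr linearB /= umbralMX.
have -> p : p * r%:P = r *: p by rewrite mulrC mul_polyC.
rewrite linearZ /= !umbE -!QE Q'E risingSl (risingS N.+1); ring.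
Qed.

Lemma umbral_rising_neq0 n (p : {poly C}) x :
    (size p <= n.+1)%N -> (forall z, `|z| < 1 -> ~~ root p z) -> 0 < 'Re x ->
  umbral (rising n.+1) x p != 0.
Proof.
move=> le_pn rootp x0; have [rs defp] := closed_field_poly_normal p.
have p0 : p != 0.
  by apply: contraNneq (rootp 0 _) => [->|]; rewrite ?root0 ?normr0 ?ltr01.
have lp0 : lead_coef p != 0 by rewrite lead_coef_eq0.
have rs1 : all (fun r => 1 <= `|r|) rs.
  apply/allP=> r rsr; rewrite real_leNgt ?normr_real ?rpred1 //.
  apply/negP=> /rootp/negP; apply.
  by rewrite defp rootZ // root_prod_XsubC.
have sz : (size rs + (n - size rs) = n)%N.
  rewrite subnKC //; move: le_pn; rewrite defp size_scale //.
  by rewrite size_prod_XsubC.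
have [zs [c c0 [le_zs umbE]]] := umbral_rising_prod rs1 sz.
rewrite defp linearZ /= umbE !mulf_neq0 //.
  rewrite /rising; apply/prodf_neq0 => i _; apply: contraTneq x0 => /eqP.
  rewrite addr_eq0 => /eqP ->; rewrite raddfN /= (Creal_ReP _ _) ?rpred_nat //.
  by rewrite oppr_gt0 ltrn0.
rewrite prodf_seq_neq0; apply/allP=> z /le_zs hz; apply/implyP=> _.
rewrite subr_eq0; apply: contraTneq x0 => ->; rewrite -real_leNgt ?Creal_Re //.
by apply: le_trans hz _; rewrite oppr_le0 mulr_ge0 ?invr_ge0 ?ler0n.
Qed.

(** The quotient is the inverse of 1/(1 - a) + 1/(1 - b) - 1, and 1/(1 - a)
    maps the unit disc to the half-plane Re >= 1/2; clearing denominators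
    turns this into a polynomial identity that also covers a = 1 and b = 1. *)
Lemma Re_mobius_ge0 (a b : C) : `|a| <= 1 -> `|b| <= 1 ->
  0 <= 'Re ((1 - a) * (1 - b) / (1 - a * b)).
Proof.
move=> a1 b1; set v := 1 - a * b.
have [->|v0] := eqVneq v 0; first by rewrite invr0 mulr0 raddf0.
have vv0 : v^* != 0 by rewrite conjC_eq0.
have -> : 'Re ((1 - a) * (1 - b) / v) =
    ((1 - `|a| ^+ 2) * `|1 - b| ^+ 2 + (1 - `|b| ^+ 2) * `|1 - a| ^+ 2)
      / (2 * `|v| ^+ 2).
  rewrite ReE !normCK rmorphM /= fmorphV /= rmorphM /=.
  move: v0 vv0; rewrite /v !rmorphB /= !rmorphM !rmorph1 => v0 vv0.
  by field; rewrite v0 vv0.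
rewrite mulr_ge0 ?invr_ge0 ?mulr_ge0 ?exprn_ge0 //.
by rewrite addr_ge0 // mulr_ge0 ?exprn_ge0 // subr_ge0 exprn_ile1.
Qed.

(** Divided by 1 - t^n, the first sum has nonnegative real part and the last
    term is 2 x. *)
Lemma sum_mobius_neq0 (I : finType) (k : I -> nat) n x t :
    (0 < n)%N -> (forall i, k i <= n)%N -> 0 < 'Re x -> `|t| < 1 ->
  \sum_i (1 - t ^+ k i) * (1 - t ^+ (n - k i)) + 2 * x * (1 - t ^+ n) != 0.
Proof.
move=> n0 le_kn x0 t1.
have le1 j : `|t ^+ j| <= 1 by rewrite normrX exprn_ile1 // ltW.
have tn : 1 - t ^+ n != 0.
  rewrite subr_eq0 eq_sym; apply: contraTneq t1 => /(congr1 Num.norm)/eqP.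
  rewrite normrX normr1 => tn1; rewrite -real_leNgt ?normr_real ?rpred1 //.
  by rewrite -(@ler_pXn2r _ n) ?nnegrE ?ler01 // expr1n (eqP tn1).
apply/eqP => /(congr1 (fun y => 'Re (y / (1 - t ^+ n)))) /eqP.
rewrite mul0r raddf0 mulrDl mulfK // mulr_suml raddfD raddf_sum /=.
rewrite gt_eqF // ltr_wpDl ?sumr_ge0 // => [i _|].
  by rewrite -[in X in _ / (1 - X)](subnKC (le_kn i)) exprD Re_mobius_ge0.
by rewrite ReMl ?mulr_gt0 // rpred_nat.
Qed.

End HalfPlane.

(** * The recurrence satisfied by the cycle-type formula *)

Section Stanley.
Local Open Scope ring_scope.
Variables (R : comNzRingType) (x : R).
Implicit Types (h : {poly R}) (ks : seq nat).

(** The backward difference of x (x + 1) ... (x + n) is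
    (n + 1) x (x + 1) ... (x + n - 1). *)
Lemma umbral_rising_diff n h :
  umbral (rising n.+1) x ((1 - 'X) * h) = n.+1%:R * umbral (rising n) x h.
Proof.
rewrite -[h]coefK poly_def mulr_sumr !linear_sum mulr_sumr; apply: eq_bigr => k _.
rewrite -scalerAr !linearZ /= mulrCA; congr (_ * _).
rewrite mulrBl mul1r mulrC linearB /= umbralMX !umbralXn addrAC risingSl risingS.
by rewrite -natr1; ring.
Qed.

(** Multiplication by x does not commute with the shift E: the commutator of
    x with h(E) is the operator (t h')(E). This is where a derivative enters
    the recurrence below. *)
Lemma umbral_rising_mul n h :
  x * umbral (rising n) x h =
  umbral (rising n.+1) x h + umbral (rising n) x ('X * h^`() - n%:R *: h).
Proof.
rewrite -[h]coefK poly_def; elim/big_ind: _ => [|p q IHp IHq|k _].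
- by rewrite deriv0 !mulr0 scaler0 subrr !linear0 mulr0 addr0.
- rewrite derivD mulrDr scalerDr opprD addrACA [in RHS]linearD.
  by rewrite [umbral (rising n) x (_ + _)]linearD linearD mulrDr IHp IHq addrACA.
rewrite linearZ /= derivZ derivXn.
rewrite -scalerAr; move: (h`_k) (nat_of_ord k) => c j.
have -> : 'X * ('X^(j.-1) *+ j) = j%:R *: 'X^j :> {poly R}.
  case: j => [|j] /=; first by rewrite mulr0n mulr0 scale0r.
  by rewrite scaler_nat mulrnAr -exprS.
rewrite linearB !linearZ /= !umbralXn risingS; ring.
Qed.

Definition cycle_poly ks : {poly R} := \prod_(k <- ks | (0 < k)%N) (1 - 'X^k).

Lemma cycle_poly_cons k ks : (0 < k)%N -> cycle_poly (k :: ks) = (1 - 'X^k) * cycle_poly ks.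
Proof. by move=> k0; rewrite /cycle_poly big_cons k0. Qed.

Lemma cycle_poly_cons0 ks : cycle_poly (0%N :: ks) = cycle_poly ks.
Proof. by rewrite /cycle_poly big_cons. Qed.

Lemma perm_cycle_poly ks ks' : perm_eq ks ks' -> cycle_poly ks = cycle_poly ks'.
Proof. exact: perm_big. Qed.

Lemma perm_rem_cons k k0 ks : k \in ks -> perm_eq (rem k (k0 :: ks)) (k0 :: rem k ks).
Proof.
move=> ks_k; have ks0_k : k \in k0 :: ks by rewrite inE ks_k orbT.
apply/seq.permP=> p; have := seq.permP (perm_to_rem ks0_k) p.
by move: (rem k (k0 :: ks)) => l /=; rewrite (seq.permP (perm_to_rem ks_k)) /=; lia.
Qed.

(** The logarithmic derivative of a product; the entries 0 of ks, which give
    no factor, have weight 0. *)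
Lemma deriv_cycle_poly ks :
  'X * (cycle_poly ks)^`() =
  - \sum_(k <- ks) k%:R *: ('X^k * cycle_poly (rem k ks)).
Proof.
elim: ks => [|k0 ks IHks].
  by rewrite /cycle_poly !big_nil derivC mulr0 oppr0.
rewrite big_cons /= eqxx opprD.
have [->|k0_gt0] := posnP k0.
  rewrite cycle_poly_cons0 IHks scale0r oppr0 add0r; congr (- _).
  apply: eq_big_seq => k ks_k.
  by rewrite (perm_cycle_poly (perm_rem_cons _ ks_k)) cycle_poly_cons0.
rewrite cycle_poly_cons // derivM mulrDr [in X in _ + X]mulrCA IHks mulrN mulr_sumr.
congr (_ + _).
  rewrite derivB derivC derivXn sub0r -scaler_nat -!mul_polyC.
  by rewrite -[in RHS](prednK k0_gt0) exprS (prednK k0_gt0); ring.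
congr (- _); apply: eq_big_seq => k ks_k.
rewrite (perm_cycle_poly (perm_rem_cons _ ks_k)) cycle_poly_cons //.
by rewrite -scalerAr; congr (_ *: _); ring.
Qed.

(** Stanley's generating function for products with a cyclic permutation.
    A cycle type ks of size N stands for a permutation w, its entries counting
    the marked points on each cycle of w. The value is N (N + 1) times the
    sum of x^c over the cyclic permutations u of the marked points, c being
    the number of cycles of u w; each unmarked cycle of w survives in u w and
    contributes a factor x. *)
Definition stanley ks : R :=
  x ^+ count_mem 0%N ks * umbral (rising (sumn ks).+1) x (cycle_poly ks).

Lemma perm_stanley ks ks' : perm_eq ks ks' -> stanley ks = stanley ks'.
Proof.
move=> eq_ks; rewrite /stanley (perm_cycle_poly eq_ks) (perm_sumn eq_ks).
by rewrite (seq.permP eq_ks).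
Qed.

Lemma sum_cut_poly m :
  (1 - 'X) * (\sum_(r < m) (1 - 'X^r) * (1 - 'X^(m - r))) =
  (1 - 'X) * m%:R%:P * (1 + 'X^m) - (1 + 'X) * (1 - 'X^m) :> {poly R}.
Proof.
have geo : (1 - 'X) * (\sum_(r < m) 'X^r) = 1 - 'X^m :> {poly R}.
  by rewrite -[RHS]opprB subrX1 -mulNr opprB.
have rev : \sum_(r < m) 'X^(m - r) = 'X * \sum_(r < m) 'X^r :> {poly R}.
  rewrite mulr_sumr (reindex_inj rev_ord_inj) /=; apply: eq_bigr => r _.
  by rewrite subKn // exprS.
have -> : \sum_(r < m) (1 - 'X^r) * (1 - 'X^(m - r)) =
    m%:R%:P * (1 + 'X^m) - (1 + 'X) * \sum_(r < m) 'X^r :> {poly R}.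
  rewrite mulrDl mul1r -rev opprD addrA.
  have -> : m%:R%:P * (1 + 'X^m) = \sum_(r < m) (1 + 'X^m) :> {poly R}.
    by rewrite sumr_const card_ord polyC_natr mulr_natl.
  rewrite -!sumrB; apply: eq_bigr => r _.
  have -> : 'X^m = 'X^r * 'X^(m - r) :> {poly R} by rewrite -exprD subnKC // ltnW.
  ring.
rewrite mulrBr mulrA; congr (_ - _).
by rewrite mulrCA geo.
Qed.

(** For r = 0 a cycle without marked points splits off, which brings the
    factor x; the polynomial (1 - t^r) (1 - t^(m - r)) vanishes then, so that
    the second sum may start at 0. *)
Lemma sum_cut_stanley m ks (n := (m + sumn ks)%N) (G := cycle_poly ks) :
  \sum_(r < m) stanley [:: r : nat, (m - r)%N & ks] =
  x ^+ count_mem 0%N ks * (x * umbral (rising n.+1) x ((1 - 'X^m) * G) +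
    umbral (rising n.+1) x ((\sum_(r < m) (1 - 'X^r) * (1 - 'X^(m - r))) * G)).
Proof.
rewrite mulr_suml [umbral _ _ (\sum_(r < m) _)]linear_sum mulrDr [_ * \sum_(r < m) _]mulr_sumr.
case: m @n => [|m] n; first by rewrite !big_ord0 expr0 subrr mul0r linear0 !mulr0 addr0.
rewrite !big_ord_recl expr0 subrr !mul0r linear0 mulr0 add0r; congr (_ + _).
  rewrite /stanley /= cycle_poly_cons0 cycle_poly_cons // add0n subn0 !add0n.
  by rewrite [x ^+ (1 + _)]exprS -mulrA mulrCA.
apply: eq_bigr => r _; rewrite /stanley /= /bump /= !add1n !subSS.
have mr : (0 < m - r)%N by rewrite subn_gt0.
rewrite (gtn_eqF mr) !add0n !cycle_poly_cons // mulrA; congr (_ * umbral (rising _) _ _).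
by rewrite addnA addSn subnKC // ltnW.
Qed.

Lemma sum_join_stanley m ks (n := (m + sumn ks)%N) :
  \sum_(k <- ks) k%:R * stanley ((m + k)%N :: rem k ks) =
  x ^+ count_mem 0%N ks * umbral (rising n.+1) x
     (\sum_(k <- ks) k%:R *: ((1 - 'X^(m + k)) * cycle_poly (rem k ks))).
Proof.
rewrite linear_sum mulr_sumr; apply: eq_big_seq => k ks_k.
have [->|k0] := posnP k; first by rewrite !scale0r linear0 mul0r mulr0.
have eq_ks := perm_to_rem ks_k.
rewrite linearZ /= /stanley /= cycle_poly_cons ?addn_gt0 ?k0 ?orbT //.
rewrite addn_eq0 (gtn_eqF k0) andbF add0n mulrCA.
rewrite /n (perm_sumn eq_ks) (seq.permP eq_ks) /= (gtn_eqF k0) add0n -addnA.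
by [].
Qed.

(** The two sums are the effect of unmarking a point of a cycle with m + 1
    marked points and multiplying by the transposition of this point with
    another marked one: either its cycle is cut, in all the ways r + (m - r),
    or it is joined to a cycle with k marked points, in k ways. Once all terms
    are written as values of functionals of the same degree, the recurrence is
    an identity between polynomials in t, in which the joins cancel against
    the logarithmic derivative of the product over ks. *)
Lemma stanley_rec m ks (n := (m.+1 + sumn ks)%N) :
  n.-1%:R * stanley (m.+1 :: ks) = n.+1%:R *
   (\sum_(r < m) stanley [:: r : nat, (m - r)%N & ks] +
    \sum_(k <- ks) k%:R * stanley ((m + k)%N :: rem k ks)).
Proof.
rewrite sum_cut_stanley sum_join_stanley -mulrDr [RHS]mulrCA /stanley /= add0n.
rewrite cycle_poly_cons // [LHS]mulrCA; congr (_ * _); rewrite -addSn -/n.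
set G := cycle_poly ks.
set cuts := \sum_(r < m) _; set joins := \sum_(k <- ks) _.
rewrite umbral_rising_mul -!addrA -!linearD /= mulrDr -!umbral_rising_diff.
rewrite -!linearZ -!linearD /=; congr umbral.
have derivE : 'X * ((1 - 'X^m) * G)^`() =
    - (m%:R%:P * 'X^m * G) + (1 - 'X^m) * ('X * G^`()).
  rewrite derivM derivB derivC derivXn sub0r.
  have -> : m%:R%:P * 'X^m = 'X * ('X^(m.-1) *+ m) :> {poly R}.
    case: m @n @cuts @joins => [|j] *; first by rewrite mulr0n mulr0 mul0r.
    by rewrite polyC_natr mulr_natl mulrnAr -exprS.
  ring.
have joinsE : joins + (1 - 'X^m) * ('X * G^`()) = (sumn ks)%:R *: G.
  rewrite deriv_cycle_poly mulrN mulr_sumr -sumrB sumnE natr_sum scaler_suml.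
  apply: eq_big_seq => k ks_k; have [->|k0] := posnP k.
    by rewrite !scale0r mulr0 subr0.
  rewrite [G](perm_cycle_poly (perm_to_rem ks_k)) cycle_poly_cons // exprD.
  by rewrite -!mul_polyC; ring.
rewrite derivE mulrDr !mulrDr [_ * (cuts * G)]mulrA sum_cut_poly.
have -> : joins = (sumn ks)%:R *: G - (1 - 'X^m) * ('X * G^`()).
  by rewrite -joinsE addrK.
move: (_ * G^`()) => S; move: (sumn ks) => s.
rewrite -!mul_polyC !addSn -!natr1 !natrD !exprS !raddfD /= polyC1; ring.
Qed.

End Stanley.

(** * Cycles of a permutation as lists *)

Section CycleDecomposition.
Variable T : finType.
Implicit Types (w u : {perm T}) (A : {set T}) (c s : seq T) (cs : seq (seq T)).

(** Cycles as lists make cutting and joining explicit, and keep the fixed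
    points as cycles of length 1. *)
Definition cycle_decomposition w cs : Prop :=
  [/\ perm_eq (flatten cs) (enum T), [::] \notin cs & all (fcycle w) cs].

Lemma perm_cycle_decomposition w cs cs' :
  perm_eq cs cs' -> cycle_decomposition w cs -> cycle_decomposition w cs'.
Proof.
move=> eq_cs [flat_cs nil_cs cyc_cs]; split.
- by rewrite -(permPl (perm_flatten eq_cs)).
- by rewrite -(perm_mem eq_cs).
- by rewrite -(perm_all _ eq_cs).
Qed.

Lemma rot_cycle_decomposition w c cs x : x \in c ->
    cycle_decomposition w (c :: cs) ->
  exists2 s, perm_eq (x :: s) c & cycle_decomposition w ((x :: s) :: cs).
Proof.
move=> c_x [flat_cs nil_cs /= /andP[cyc_c cyc_cs]].
case: (rot_to c_x) => i s eq_c; exists s; first by rewrite -eq_c perm_rot.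
split; last by rewrite /= cyc_cs andbT -[path _ _ _]/(path.cycle _ (x :: s)) -eq_c rot_cycle.
  by apply: perm_trans flat_cs; rewrite -eq_c /= perm_cat2r perm_rot.
by move: nil_cs; rewrite !inE !negb_or => /andP[].
Qed.

Lemma mem_cycle_decomposition w cs x :
  cycle_decomposition w cs -> exists2 c, c \in cs & x \in c.
Proof.
by case=> flat_cs _ _; apply/flattenP; rewrite (perm_mem flat_cs) mem_enum.
Qed.

Lemma head_cycle_decomposition w cs x : cycle_decomposition w cs ->
  exists s cs', [/\ cycle_decomposition w ((x :: s) :: cs'),
     size cs = (size cs').+1 &
     forall a : pred T, perm_eq (map (count a) cs) (count a (x :: s) :: map (count a) cs')].
Proof.
move=> dec_cs; have [c cs_c c_x] := mem_cycle_decomposition x dec_cs.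
have eq_cs := perm_to_rem cs_c.
have [s eq_c dec_s] := rot_cycle_decomposition c_x (perm_cycle_decomposition eq_cs dec_cs).
exists s, (rem c cs); split=> //; first by rewrite (perm_size eq_cs).
move=> a; rewrite (permPl (perm_map (count a) eq_cs)) /=.
by rewrite -(seq.permP eq_c a).
Qed.

(** Two permutations that differ only at the start of a path have the same
    paths from different starting points: this is how a transposition
    reconnects cycles. *)
Lemma fpath_swap w w' b b' e s : w' b' = w b -> {in s, w' =1 w} ->
  path (frel w') b' (rcons s e) = path (frel w) b (rcons s e).
Proof.
move=> eq_b; elim: s b b' eq_b => [|y s IHs] b b' eq_b eq_w /=; rewrite eq_b //.
rewrite (IHs y) // ?eq_w ?mem_head // => z s_z; apply: eq_w.
by rewrite inE s_z orbT.
Qed.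

Lemma fcycle_tperm w a j c : a \notin c -> j \notin c ->
  fcycle (tperm a j * w)%g c = fcycle w c.
Proof.
have tE z : a != z -> j != z -> (tperm a j * w)%g z = w z.
  by move=> az jz; rewrite permM tpermD.
case: c => // y c; rewrite !inE !negb_or => /andP[ay ac] /andP[jy jc].
apply: fpath_swap => [|z c_z]; first by rewrite tE.
by rewrite tE //; [apply: contraNneq ac => -> | apply: contraNneq jc => ->].
Qed.

Lemma flatten_notin c cs x : x \notin flatten cs -> c \in cs -> x \notin c.
Proof. by move=> nx cs_c; apply: contra nx => c_x; apply/flattenP; exists c. Qed.

Lemma perm_cat_swap s1 s2 a j cs :
  perm_eq (flatten ((a :: s1 ++ j :: s2) :: cs)) (flatten [:: a :: s2, j :: s1 & cs]).
Proof.
by apply/seq.permP => p; do 3!rewrite /= ?count_cat; lia.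
Qed.

Lemma uniq_cut s1 s2 a j cs : uniq (flatten ((a :: s1 ++ j :: s2) :: cs)) ->
  [/\ a != j, {in s1, forall y, a != y /\ j != y}, {in s2, forall y, a != y /\ j != y} &
      {in cs, forall c, a \notin c /\ j \notin c}].
Proof.
rewrite /= -catA mem_cat cat_uniq /= inE !mem_cat !negb_or.
case/andP=> /and4P[as1 aj as2 acs] /and3P[_ /andP[js1 _] /andP[/andP[js2 jcs] _]].
split=> // [y|y|c].
- by move=> s1_y; split; [apply: contraNneq as1 | apply: contraNneq js1] => ->.
- by move=> s2_y; split; [apply: contraNneq as2 | apply: contraNneq js2] => ->.
- by move=> cs_c; rewrite !(flatten_notin _ cs_c).
Qed.

Lemma cut_cycle_decomposition w a s1 j s2 cs :
    cycle_decomposition w ((a :: s1 ++ j :: s2) :: cs) ->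
  cycle_decomposition (tperm a j * w)%g [:: a :: s2, j :: s1 & cs].
Proof.
case=> flat_cs nil_cs cyc_cs.
have : uniq (flatten ((a :: s1 ++ j :: s2) :: cs)) by rewrite (perm_uniq flat_cs) enum_uniq.
case/uniq_cut=> aj s1D s2D csD; split.
- by rewrite -(permPl (perm_cat_swap _ _ _ _ _)).
- by move: nil_cs; rewrite !inE.
move: cyc_cs; rewrite /= rcons_cat -cat_rcons cat_path last_rcons.
case/andP=> /andP[cyc1 cyc2] cyc_cs; apply/and3P; split.
- rewrite (@fpath_swap w _ j) // ?permM ?tpermL // => y /s2D[ay jy].
  by rewrite permM tpermD.
- rewrite (@fpath_swap w _ a) // ?permM ?tpermR // => y /s1D[ay jy].
  by rewrite permM tpermD.
by apply/allP=> c cs_c; have [ac jc] := csD c cs_c; rewrite fcycle_tperm // (allP cyc_cs).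
Qed.

Lemma join_cycle_decomposition w a s1 j s2 cs :
    cycle_decomposition w [:: a :: s2, j :: s1 & cs] ->
  cycle_decomposition (tperm a j * w)%g ((a :: s1 ++ j :: s2) :: cs).
Proof.
case=> flat_cs nil_cs cyc_cs.
have flat : perm_eq (flatten ((a :: s1 ++ j :: s2) :: cs)) (enum T).
  by rewrite (permPl (perm_cat_swap _ _ _ _ _)).
have : uniq (flatten ((a :: s1 ++ j :: s2) :: cs)) by rewrite (perm_uniq flat) enum_uniq.
case/uniq_cut=> aj s1D s2D csD; split=> //.
move: cyc_cs; rewrite /= rcons_cat -cat_rcons cat_path last_rcons.
case/and3P=> cyc2 cyc1 cyc_cs; apply/andP; split; first (apply/andP; split).
- rewrite (@fpath_swap w _ j) // ?permM ?tpermL // => y /s1D[ay jy].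
  by rewrite permM tpermD.
- rewrite (@fpath_swap w _ a) // ?permM ?tpermR // => y /s2D[ay jy].
  by rewrite permM tpermD.
by apply/allP=> c cs_c; have [ac jc] := csD c cs_c; rewrite fcycle_tperm // (allP cyc_cs).
Qed.

Lemma porbit_fcycle w c x : fcycle w c -> x \in c -> porbit w x = [set y in c].
Proof.
move=> cyc_c c_x; apply/setP=> y; rewrite inE -(fconnect_cycle cyc_c c_x).
apply/porbitP/idP => [[i ->]|/iter_findex <-]; first by rewrite permX fconnect_iter.
by exists (findex w x y); rewrite permX.
Qed.

Lemma card_porbits w cs : cycle_decomposition w cs -> #|porbits w| = size cs.
Proof.
case=> flat_cs nil_cs cyc_cs.
have uniq_cs : uniq (flatten cs) by rewrite (perm_uniq flat_cs) enum_uniq.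
pose f c := [set y in c].
have porbitsE : porbits w =i map f cs.
  move=> O; apply/imsetP/mapP => [[x _ ->]|[c cs_c ->]].
    have /flattenP[c cs_c c_x] : x \in flatten cs by rewrite (perm_mem flat_cs) mem_enum.
    by exists c => //; rewrite (porbit_fcycle (allP cyc_cs c cs_c)).
  case: c cs_c => [|x c] cs_c; first by rewrite cs_c in nil_cs.
  by exists x => //; rewrite (porbit_fcycle (allP cyc_cs _ cs_c)) ?mem_head.
rewrite (eq_card porbitsE) (card_uniqP _) ?size_map //.
elim: cs uniq_cs nil_cs {flat_cs cyc_cs porbitsE} => //= c cs IHcs.
rewrite cat_uniq inE negb_or => /and3P[_ disj uniq_cs] /andP[c0 nil_cs].
rewrite IHcs // andbT; apply/mapP => -[c' cs_c' eq_c].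
case: c c0 disj eq_c => // x c _ /hasPn disj /setP/(_ x).
rewrite !inE eqxx /= => /esym c'_x.
by have := disj x; rewrite mem_head; case/(_ _)/negP=> //; apply/flattenP; exists c'.
Qed.

End CycleDecomposition.

Section CyclicOn.
Variable T : finType.
Implicit Types (w u : {perm T}) (A : {set T}).

(** The cyclic permutations of A, for A nonempty: their cycles are A and the
    singletons outside A. The count of cycles is the form that behaves well
    under multiplication by a transposition. *)
Definition cyclic_on A : {set {perm T}} :=
  [set u | perm_on A u && (#|porbits u| == #|~: A|.+1)].

Lemma porbit_fixed u x : u x = x -> porbit u x = [set x].
Proof.
move=> ux; rewrite (@porbit_fcycle _ u [:: x]) ?mem_head /= ?ux ?eqxx //.
by apply/setP=> y; rewrite !inE.
Qed.

Lemma card_porbits_perm_on A u : perm_on A u ->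
  #|porbits u| = (#|porbit u @: A| + #|~: A|)%N.
Proof.
move=> uA; have uC x : x \in ~: A -> porbit u x = [set x].
  by rewrite inE => /(out_perm uA) /porbit_fixed.
have -> : porbits u = porbit u @: A :|: set1 @: ~: A.
  rewrite -(eq_in_imset uC) -imsetU setUCr /porbits.
  by apply/setP=> O; apply/imsetP/imsetP=> -[x _ ->]; exists x; rewrite ?inE.
rewrite cardsU (card_imset _ set1_inj) (_ : _ :&: _ = set0) ?cards0 ?subn0 //.
apply/setP=> O; rewrite !inE; apply/andP=> -[/imsetP[x Ax ->] /imsetP[y]].
rewrite inE => nAy /setP/(_ x); rewrite porbit_id inE => /esym/eqP eq_xy.
by rewrite -eq_xy Ax in nAy.
Qed.

Lemma card_porbits_perm_on_gt A u : A != set0 -> perm_on A u ->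
  (#|~: A| < #|porbits u|)%N.
Proof.
move=> A0 uA; rewrite (card_porbits_perm_on uA).
by rewrite -[ltnLHS]add0n ltn_add2r card_gt0 imset_eq0.
Qed.

Lemma cyclic_on_porbit A u a : a \in A ->
  (u \in cyclic_on A) = perm_on A u && [forall b in A, porbit u b == A].
Proof.
move=> Aa; rewrite inE; apply: andb_id2l => uA.
rewrite (card_porbits_perm_on uA) -addn1 addnC eqn_add2l.
apply/cards1P/forall_inP => [[O eqO] b Ab|eqA].
  have eqOb c : c \in A -> porbit u c = O.
    by move=> Ac; apply/set1P; rewrite -eqO imset_f.
  rewrite eqOb //; apply/eqP/setP=> c; apply/idP/idP => [|Ac].
    rewrite -(eqOb b Ab) => /porbitP[i ->].
    by rewrite permX; elim: i => //= i IHi; rewrite perm_closed.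
  by rewrite -(eqOb c Ac) porbit_id.
exists A; apply/setP=> O; rewrite inE; apply/imsetP/eqP => [[b Ab ->]|->].
  exact/eqP/eqA.
by exists a => //; apply/esym/eqP/eqA.
Qed.

Lemma card_setCD1 A a : a \in A -> #|~: (A :\ a)| = #|~: A|.+1.
Proof. by move=> Aa; rewrite setCD setUC cardsU1 inE Aa. Qed.

Lemma perm_onD1 A u a : perm_on (A :\ a) u = perm_on A u && (u a == a).
Proof.
apply/subsetP/andP => [uA|[/subsetP uA /eqP ua] x ux].
  split; first by apply/subsetP=> x /uA; rewrite inE => /andP[].
  by apply: contraT => /uA; rewrite !inE eqxx.
by rewrite !inE uA // andbT; apply: contraNneq ux => ->; apply/eqP.
Qed.

(** The product inserts a into the cycle of u, just before j. *)
Lemma cyclic_on_tperm A u a j : a \in A -> j \in A -> a != j -> u a = a ->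
  ((u * tperm a j)%g \in cyclic_on A) = (u \in cyclic_on (A :\ a)).
Proof.
move=> Aa Aj aj ua; rewrite !inE.
have tA : perm_on A (tperm a j).
  by apply/subsetP=> x; rewrite inE; case: tpermP => [->|->|_ _ /eqP].
have -> : perm_on A (u * tperm a j)%g = perm_on (A :\ a) u.
  rewrite perm_onD1 ua eqxx andbT.
  apply/idP/idP => uA; last exact: perm_onM.
  by rewrite -[u](mulgK (tperm a j)) tpermV perm_onM.
congr (_ && _).
have -> : (u * tperm a j = tperm a (u^-1%g j) * u)%g.
  by rewrite [RHS]conjgC tpermJ ua permKV.
have := porbits_mul_tperm u a (u^-1%g j).
have aj' : a != (u^-1)%g j.
  by apply: contraNneq aj => /(congr1 u); rewrite permKV ua => ->.
rewrite porbit_sym porbit_fixed // inE eq_sym aj' /= => porbits_tperm.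
by rewrite card_setCD1 //; apply/eqP/eqP; lia.
Qed.

Lemma cyclic_on_moved A u a : a \in A -> (1 < #|A|)%N -> u \in cyclic_on A ->
  u a \in A :\ a.
Proof.
move=> Aa A1; rewrite !inE => /andP[uA /eqP cu]; rewrite perm_closed // Aa andbT.
apply: contra_eqN cu => /eqP ua; rewrite gtn_eqF //.
rewrite -(card_setCD1 Aa); apply: card_porbits_perm_on_gt; last by rewrite perm_onD1 uA ua eqxx.
by rewrite -card_gt0; move: A1; rewrite (cardsD1 a) Aa.
Qed.

Lemma cyclic_on_tpermP A u a : a \in A -> (1 < #|A|)%N -> u \in cyclic_on A ->
  exists j u', [/\ j \in A :\ a, u' \in cyclic_on (A :\ a) & u = (u' * tperm a j)%g].
Proof.
move=> Aa A1 uA; have uaA := cyclic_on_moved Aa A1 uA.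
have uE : u = (u * tperm a (u a) * tperm a (u a))%g.
  by rewrite -{1}[u](mulgK (tperm a (u a))) tpermV.
exists (u a), (u * tperm a (u a))%g; split=> //.
move: uaA; rewrite inE => /andP[uaa uaA].
rewrite -(@cyclic_on_tperm _ _ _ (u a)) -?uE // 1?eq_sym ?permM ?tpermR //.
by move: uaa; rewrite inE.
Qed.

Lemma sum_cyclic_on (V : nmodType) (F : {perm T} -> V) A a :
    a \in A -> (1 < #|A|)%N ->
  (\sum_(u in cyclic_on A) F u =
   \sum_(j in A :\ a) \sum_(u in cyclic_on (A :\ a)) F (u * tperm a j)%g)%R.
Proof.
move=> Aa A1; rewrite (partition_big (fun u => u a) (mem (A :\ a))) /=; last first.
  by move=> u; apply: cyclic_on_moved.
apply: eq_bigr => j; rewrite !inE => /andP[ja Aj].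
rewrite (reindex_inj (mulIg (tperm a j))) /=; apply: eq_bigl => u.
have [ua|ua] := eqVneq (u a) a.
  by rewrite cyclic_on_tperm // 1?eq_sym // permM ua tpermL eqxx andbT.
rewrite permM -(inj_eq (@perm_inj _ (tperm a j))) tpermK tpermR (negbTE ua) andbF.
by rewrite !inE perm_onD1 (negbTE ua) andbF.
Qed.

Lemma cyclic_on1 a : cyclic_on [set a] = [set 1%g].
Proof.
apply/setP=> u; rewrite (cyclic_on_porbit _ (set11 a)) inE; apply/andP/eqP => [[ua _]|->].
  apply/permP=> x; rewrite perm1; have [->|xa] := eqVneq x a.
    by apply/set1P; rewrite (perm_closed _ ua) set11.
  by rewrite (out_perm ua) // inE.
rewrite perm_on1; split=> //; apply/forall_inP=> b /set1P->.
by rewrite porbit_fixed ?perm1.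
Qed.

End CyclicOn.

(** * Products with a random cycle *)

Section FaceSum.
Variable T : finType.
Implicit Types (w u : {perm T}) (A : {set T}) (c s : seq T) (cs : seq (seq T)).

(** The number of marked entries of s after a given one of them takes each
    value below their total number once. *)
Lemma sum_after (V : nmodType) (phi : nat -> V) (a : pred T) s : uniq s ->
  (\sum_(j <- s | a j) phi (count a (drop (index j s).+1 s)) =
   \sum_(r < count a s) phi r)%R.
Proof.
elim: s => [|y s IHs] /=; first by rewrite big_nil big_ord0.
case/andP=> nsy uniq_s; rewrite big_cons /= eqxx drop0.
have -> : (\sum_(j <- s | a j) phi (count a (drop (if y == j then 0%N else (index j s).+1) s)) =
           \sum_(j <- s | a j) phi (count a (drop (index j s).+1 s)))%R.
  rewrite !(big_seq_cond a); apply: eq_bigr => j /andP[s_j _].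
  by rewrite ifN //; apply: contraNneq nsy => ->.
by rewrite IHs //; case: (a y); rewrite // big_ord_recr addrC.
Qed.

Lemma count_setD1 A a s : a \notin s -> count (mem (A :\ a)) s = count (mem A) s.
Proof.
move=> nsa; apply: eq_in_count => y s_y; rewrite !inE; case: eqP s_y => // -> s_a.
by rewrite s_a in nsa.
Qed.

Lemma sumn_count A w cs : cycle_decomposition w cs ->
  sumn (map (count (mem A)) cs) = #|A|.
Proof.
case=> flat_cs _ _; rewrite -count_flatten (seq.permP flat_cs).
by rewrite cardE -size_filter; congr size; rewrite enumT.
Qed.

Variables (R : numDomainType) (x : R).

Definition face_sum A w : R := (\sum_(u in cyclic_on A) x ^+ #|porbits (u * w)%g|)%R.

Lemma face_sum_rec A a w : a \in A -> (1 < #|A|)%N ->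
  (face_sum A w = \sum_(j in A :\ a) face_sum (A :\ a) (tperm a j * w)%g)%R.
Proof.
move=> Aa A1; rewrite /face_sum (sum_cyclic_on _ Aa) //.
by apply: eq_bigr => j _; apply: eq_bigr => u _; rewrite mulgA.
Qed.

Lemma face_sum1 a w : face_sum [set a] w = (x ^+ #|porbits w|)%R.
Proof. by rewrite /face_sum cyclic_on1 big_set1 mul1g. Qed.

Lemma sum_cycle_decomposition (V : nmodType) (f : T -> V) w cs (a : pred T) :
  cycle_decomposition w cs -> (\sum_(j | a j) f j = \sum_(c <- cs) \sum_(j <- c | a j) f j)%R.
Proof.
case=> flat_cs _ _; rewrite -big_flatten (perm_big _ flat_cs) /=.
by rewrite big_enum_cond.
Qed.

Lemma cut_counts A a j w s1 s2 cs (B := A :\ a) :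
    cycle_decomposition w ((a :: s1 ++ j :: s2) :: cs) -> j \in A ->
  exists2 cs', cycle_decomposition (tperm a j * w)%g cs' &
    map (count (mem B)) cs' =
    [:: count (mem A) s2, (count (mem A) (s1 ++ j :: s2) - count (mem A) s2)%N &
        map (count (mem A)) cs].
Proof.
move=> dec Aj; have [flat_cs _ _] := dec.
have : uniq (flatten ((a :: s1 ++ j :: s2) :: cs)) by rewrite (perm_uniq flat_cs) enum_uniq.
case/uniq_cut=> aj s1D s2D csD.
exists [:: a :: s2, j :: s1 & cs]; first exact: cut_cycle_decomposition.
have nas1 : a \notin s1 by apply/negP=> /s1D[/eqP].
have nas2 : a \notin s2 by apply/negP=> /s2D[/eqP].
rewrite /= !inE eqxx (eq_sym j) aj Aj /= add0n !count_setD1 // count_cat /= Aj.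
congr [:: _, _ & _]; first by rewrite addnA addnK addnC.
by apply/eq_in_map => c /csD[ac _]; rewrite count_setD1.
Qed.

Lemma perm_cons_swap (I : eqType) (y z : I) r : perm_eq [:: y, z & r] [:: z, y & r].
Proof. exact: (permEl (perm_catCA [:: y] [:: z] r)). Qed.

Lemma join_counts A a j w s c cs (B := A :\ a) :
    cycle_decomposition w ((a :: s) :: cs) -> c \in cs -> j \in c -> j \in A ->
  exists2 cs', cycle_decomposition (tperm a j * w)%g cs' &
    perm_eq (map (count (mem B)) cs')
      ((count (mem A) s + count (mem A) c)%N ::
       rem (count (mem A) c) (map (count (mem A)) cs)).
Proof.
move=> dec cs_c c_j Aj; have eq_cs := perm_to_rem cs_c.
have [s1 eq_c] : exists2 s1, perm_eq (j :: s1) c &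
    cycle_decomposition w [:: a :: s, j :: s1 & rem c cs].
  have /(rot_cycle_decomposition c_j)[s1 eq_c dec1] :
      cycle_decomposition w [:: c, a :: s & rem c cs].
    apply: perm_cycle_decomposition dec.
    by apply: perm_trans (perm_cons_swap _ _ _); rewrite perm_cons.
  exists s1 => //; apply: perm_cycle_decomposition dec1.
  exact: perm_cons_swap.
move=> /join_cycle_decomposition dec1; have [flat_cs _ _] := dec1.
have : uniq (flatten ((a :: s1 ++ j :: s) :: rem c cs)) by rewrite (perm_uniq flat_cs) enum_uniq.
case/uniq_cut=> aj s1D sD csD.
exists ((a :: s1 ++ j :: s) :: rem c cs) => //.
have nas1 : a \notin s1 by apply/negP=> /s1D[/eqP].
have nas : a \notin s by apply/negP=> /sD[/eqP].
rewrite /= !inE eqxx count_cat /= !inE eq_sym aj Aj /= add0n !count_setD1 //.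
rewrite (_ : count _ s1 + _ = count (mem A) s + count (mem A) c)%N; last first.
  by rewrite -(seq.permP eq_c (mem A)) /= Aj; lia.
rewrite (_ : map _ (rem c cs) = map (count (mem A)) (rem c cs)); last first.
  by apply/eq_in_map => d /csD[ad _]; rewrite count_setD1.
rewrite perm_cons -(perm_cons (count (mem A) c)).
rewrite -(permPr (perm_to_rem (map_f _ cs_c))) perm_sym.
exact: (perm_map _ eq_cs).
Qed.

(** By induction on A: a cyclic permutation of A is obtained from one of
    A minus a by inserting a, which replaces w by its product with a
    transposition of a and some j in A. Whether w is cut or joined
    depends on whether j lies on the cycle of a, and the outcomes are those
    that occur in the recurrence [stanley_rec]. *)
Theorem stanley_formula A w cs : cycle_decomposition w cs -> A != set0 ->
  ((#|A| * #|A|.+1)%:R * face_sum A w = stanley x (map (count (mem A)) cs))%R.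
Proof.
move En: #|A| => n; elim: n => [|[|k] IHk] in A w cs En * => dec_cs A0.
- by rewrite -card_gt0 En in A0.
- move/eqP: En => /cards1P[a eqA]; rewrite eqA face_sum1.
  have [s [cs' [dec' _ eq_ks]]] := head_cycle_decomposition a dec_cs.
  rewrite (perm_stanley _ (eq_ks _)).
  have := sumn_count [set a] dec'; rewrite cards1 /= inE eqxx -addnA => /eqP.
  rewrite -[X in _ == X]addn0 eqn_add2l addn_eq0 => /andP[/eqP s0 sum0].
  rewrite (card_porbits dec') /= s0 addn0.
  have -> : map (count (mem [set a])) cs' = nseq (size cs') 0%N.
    elim: cs' sum0 {dec' eq_ks} => //= c cs' IHcs; rewrite addn_eq0.
    by case/andP=> /eqP-> /IHcs ->.
  rewrite /stanley /= add0n count_nseq sumn_nseq mul0n mul1n.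
  have -> : cycle_poly R (1%N :: nseq (size cs') 0%N) = ((1 - 'X) * 'X^0)%R.
    rewrite cycle_poly_cons // expr1; congr (_ * _)%R.
    by elim: (size cs') => [|j IHj]; rewrite /cycle_poly ?big_nil // big_cons.
  rewrite umbral_rising_diff umbralXn subr0 /rising big_ord1 addr0 exprS mulrCA.
  by rewrite mul1n; ring.
have [a Aa] := set0Pn _ A0.
have [s [cs' [dec' _ eq_ks]]] := head_cycle_decomposition a dec_cs.
have [flat_cs _ _] := dec'.
have : uniq (flatten ((a :: s) :: cs')) by rewrite (perm_uniq flat_cs) enum_uniq.
rewrite /= mem_cat negb_or cat_uniq => /andP[/andP[nsa ncsa] /and3P[uniq_s _ _]].
rewrite (perm_stanley _ (eq_ks _)) /= Aa add1n.
set m := count (mem A) s; set ks := map _ cs'.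
have cardA : (m.+1 + sumn ks)%N = k.+2 by rewrite -En -(sumn_count A dec') /= Aa.
have k0 : (k.+1%:R != 0 :> R)%R by rewrite pnatr_eq0.
apply: (mulfI k0).
have := stanley_rec x m ks; rewrite cardA /= => ->.
rewrite mulrCA natrM mulrCA -!mulrA [RHS]mulrC.
rewrite (@face_sum_rec A a) ?En //.
have cardB : #|A :\ a| = k.+1 by have := cardsD1 a A; rewrite Aa En; lia.
have B0 : A :\ a != set0 by rewrite -card_gt0 cardB.
have IHj j cs'' : cycle_decomposition (tperm a j * w)%g cs'' ->
  ((k.+1 * k.+2)%:R * face_sum (A :\ a) (tperm a j * w)%g =
   stanley x (map (count (mem (A :\ a))) cs''))%R.
  by move=> dec; apply: IHk.
rewrite mulrA -natrM mulrCA mulrC; congr (_ * _)%R; rewrite mulr_sumr.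
rewrite (sum_cycle_decomposition _ _ dec') big_cons; congr (_ + _)%R.
  rewrite big_cons !inE eqxx /=
    -(sum_after (fun r => stanley x [:: r, (m - r)%N & ks]) (mem A) uniq_s).
  rewrite [LHS]big_seq_cond [RHS]big_seq_cond; apply: eq_big => [j|j].
    rewrite !inE; case s_j: (j \in s) => //=; case: eqP s_j => // ->.
    by rewrite (negbTE nsa).
  case/andP=> s_j; rewrite !inE => /andP[_ Aj].
  have s_split : take (index j s) s ++ j :: drop (index j s).+1 s = s.
    by rewrite -{2}(nth_index j s_j) -drop_nth ?index_mem // cat_take_drop.
  have := dec'; rewrite -{1}s_split => /(cut_counts)/(_ Aj)[cs'' /IHj-> ->].
  by rewrite s_split.
rewrite /ks big_map; apply: eq_big_seq => c cs_c.
set S := stanley x _.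
have -> : ((count (mem A) c)%:R * S = \sum_(j <- c | j \in A) S :> R)%R.
  by rewrite big_const_seq iter_addr addr0 mulr_natl.
rewrite [LHS]big_seq_cond [RHS]big_seq_cond; apply: eq_big => [j|j].
  rewrite !inE; case c_j: (j \in c) => //=; case: eqP c_j => //= -> c_a.
  by case/negP: ncsa; apply/flattenP; exists c.
case/andP=> c_j; rewrite !inE => /andP[_ Aj].
by have [cs'' /IHj-> /perm_stanley->] := join_counts dec' cs_c c_j Aj.
Qed.

(** A cyclic permutation of A is a product of |A| - 1 transpositions, each of
    which changes the number of cycles by 1 up or down. For the wheel this
    gives both that the genus is an integer and that it is not negative. *)
Lemma card_porbits_cyclic_mul A u w : A != set0 -> u \in cyclic_on A ->
  exists k, (#|porbits (u * w)%g| + k.*2 + 1 = #|porbits w| + #|A|)%N.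
Proof.
move En: #|A| => n; elim: n => [|[|n] IHn] in A u w En *.
- by move/eqP: En; rewrite cards_eq0 => /eqP->; rewrite eqxx.
- move/eqP: En => /cards1P[a ->] _; rewrite cyclic_on1 => /set1P->.
  by exists 0%N; rewrite mul1g addn0.
move=> /set0Pn[a Aa] uA.
have [|j [u' [+ u'A ->]]] := cyclic_on_tpermP Aa _ uA; first by rewrite En.
rewrite !inE eq_sym => /andP[aj Aj].
have cardB : #|A :\ a| = n.+1 by have := cardsD1 a A; rewrite Aa En; lia.
have B0 : A :\ a != set0 by rewrite -card_gt0 cardB.
have [k kE] := IHn _ u' (tperm a j * w)%g cardB B0 u'A.
have := porbits_mul_tperm w a j; rewrite aj /= => tE.
exists (k + (a \notin porbit w j))%N; rewrite -mulgA doubleD.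
by rewrite addnA addnAC kE addnAC tE; lia.
Qed.

(** If all of A lies on one cycle of w, each transposition can be made to cut
    this cycle: if a comes first and j is the last point of A along the cycle,
    then all points of A but a stay on one cycle. *)
Lemma cyclic_on_max A w c cs : cycle_decomposition w (c :: cs) -> A != set0 ->
    {subset A <= c} ->
  exists2 u, u \in cyclic_on A & (#|porbits (u * w)%g| + 1 = #|porbits w| + #|A|)%N.
Proof.
move En: #|A| => n; elim: n => [|[|n] IHn] in A w c cs En *.
- by move/eqP: En; rewrite cards_eq0 => /eqP->; rewrite eqxx.
- move/eqP: En => /cards1P[a ->] _ _ _; exists 1%g; first by rewrite cyclic_on1 set11.
  by rewrite mul1g.
move=> dec /set0Pn[a Aa] sAc.
have [s eq_c dec'] := rot_cycle_decomposition (sAc a Aa) dec.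
have {}sAc j : j \in A -> j != a -> j \in s.
  by move=> /sAc; rewrite -(perm_mem eq_c) inE => /predU1P[->|//]; rewrite eqxx.
have cardB : #|A :\ a| = n.+1 by have := cardsD1 a A; rewrite Aa En; lia.
have B0 : A :\ a != set0 by rewrite -card_gt0 cardB.
(* The last element of A in s is the first one in its reversal. *)
have : has (mem A) (rev s).
  have [j] := set0Pn _ B0; rewrite !inE => /andP[ja Aj].
  by apply/hasP; exists j => //; rewrite mem_rev sAc.
move Es: (rev s) => r hasr; case/split_find: hasr Es => j s2 s1 /= Aj /hasPn ns2.
move/(congr1 rev); rewrite revK rev_cat rev_rcons => Es; rewrite Es in dec' sAc.
have dec1 := cut_cycle_decomposition dec'.
have := perm_cycle_decomposition (perm_cons_swap _ _ _) dec1.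
case/(IHn (A :\ a))=> // [y|u].
  rewrite !inE => /andP[ya Ay]; have := sAc y Ay ya.
  rewrite mem_cat !inE !mem_rev => /or3P[->|->|/ns2]; rewrite ?orbT //.
  by rewrite /= Ay.
rewrite (card_porbits dec1) (card_porbits dec') /= mulgA => uB card_u.
exists (u * tperm a j)%g; last by rewrite card_u; lia.
have aj : a != j.
  have [flat_cs _ _] := dec'.
  have : uniq (flatten ((a :: rev s1 ++ j :: rev s2) :: cs)).
    by rewrite (perm_uniq flat_cs) enum_uniq.
  by case/uniq_cut.
rewrite cyclic_on_tperm //; apply: (@out_perm _ (A :\ a)); last by rewrite !inE eqxx.
by move: uB; rewrite inE => /andP[].
Qed.

End FaceSum.

(** * Orbits of permutations *)

Section PermFacts.
Variable T : finType.
Implicit Types (s t : {perm T}).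

Lemma card_porbits_mulC s t : #|porbits (s * t)%g| = #|porbits (t * s)%g|.
Proof.
have <- : ((t * s) ^ s^-1 = s * t)%g by rewrite conjgE invgK mulgK.
have porbitJ r q x : porbit (r ^ q)%g (q x) = q @: porbit r x.
  apply/setP=> y; apply/porbitP/imsetP => [[i ->]|[z /porbitP[i ->] ->]].
    by exists ((r ^+ i)%g x); rewrite ?mem_porbit // -conjXg permJ.
  by exists i; rewrite -conjXg permJ.
rewrite -(card_imset (porbits (t * s)) (imset_inj (@perm_inj _ s^-1%g))).
congr #|pred_of_set _|; apply/setP=> O.
apply/imsetP/imsetP => [[x _ ->]|[O' /imsetP[x _ ->] ->]].
  exists (porbit (t * s) (s x)); first exact: imset_f.
  by rewrite -porbitJ permK.
by exists (s^-1%g x); rewrite // porbitJ.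
Qed.

Lemma eq_porbit_in s t (A : {set T}) x : x \in A -> {in A, s =1 t} ->
  {in A, forall y, t y \in A} -> porbit s x = porbit t x.
Proof.
move=> Ax eq_st tA.
have iterE i : (s ^+ i)%g x = (t ^+ i)%g x /\ (t ^+ i)%g x \in A.
  elim: i => [|i [IHi Ai]]; first by rewrite !perm1.
  by rewrite !expgSr !permM IHi eq_st // tA.
by apply/setP=> y; apply/porbitP/porbitP => -[i ->]; exists i; case: (iterE i).
Qed.

(** Of the two cyclic orders of three points, the value at one of them tells
    which one s is. This is why the rotation at a rim vertex is determined by
    the successor of its spoke. *)
Lemma porbit3 s p q r : uniq [:: p; q; r] -> porbit s p = [set y in [:: p; q; r]] ->
  s p != q -> [/\ s p = r, s r = q & s q = p].
Proof.
rewrite /= !inE !negb_or => /and3P[/andP[pq pr] qr _] orb spq.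
have inorb y : y \in [:: p; q; r] -> s y \in [:: p; q; r].
  have orbE z : (z \in [:: p; q; r]) = (z \in porbit s p) by rewrite orb [RHS]inE.
  rewrite !orbE => /porbitP[i ->].
  by rewrite -permM -expgSr mem_porbit.
have not_orb c y : fcycle s c -> p \in c -> y \in [:: p; q; r] -> y \in c.
  move=> cyc_c c_p orb_y; have := porbit_fcycle cyc_c c_p.
  by rewrite orb => /setP/(_ y); rewrite inE orb_y inE => <-.
have sp : s p = r.
  have := inorb p; rewrite mem_head !inE (negbTE spq) => /(_ isT)/or3P[/eqP sp|//|/eqP//].
  have := @not_orb [:: p] q; rewrite /= sp eqxx mem_head !inE eqxx orbT.
  by move=> /(_ isT isT isT); rewrite eq_sym (negbTE pq).
have sr : s r = q.
  have := inorb r; rewrite !inE eqxx !orbT => /(_ isT)/or3P[/eqP srp|/eqP//|/eqP srr].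
    have := @not_orb [:: p; r] q; rewrite /= sp srp !inE !eqxx ?orbT.
    by move=> /(_ isT isT isT); rewrite eq_sym (negbTE pq) (negbTE qr).
  by move: pr; rewrite -(inj_eq (@perm_inj _ s)) sp srr eqxx.
split=> //; have := inorb q; rewrite !inE eqxx !orbT => /(_ isT)/or3P[/eqP//|/eqP sq|/eqP sq].
  by move: qr; rewrite -(inj_eq (@perm_inj _ s)) sq sr eqxx.
by move: pq; rewrite -(inj_eq (@perm_inj _ s)) sp sq eqxx.
Qed.

End PermFacts.

(** * Rotation systems and faces of the wheel *)

Section Wheel.
Variable m : nat.
Let n := m.+3.
Local Notation W := (wheel n).
Local Notation dartW := (dart W).
Implicit Types (i j : 'I_n) (S : {set 'I_n}) (d : dartW) (u rho : {perm dartW}).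

Lemma val_ordS i : val (ordS i) = if val i == m.+2 then 0 else (val i).+1.
Proof.
rewrite /=; case: eqP => [->|/eqP ni]; first by rewrite modnn.
by rewrite modn_small //; move: (ltn_ord i) ni; rewrite /n /=; lia.
Qed.

Lemma ordS_neq i : i != ordS i.
Proof. by apply/eqP => /(congr1 val); rewrite val_ordS; case: eqP => /=; lia. Qed.

Lemma ordS_ord_pred_neq i : ordS i != ord_pred i.
Proof.
apply/eqP => /(congr1 (@ordS n)); rewrite ord_predK => /(congr1 val).
by rewrite !val_ordS; do 2?case: eqP => /=; lia.
Qed.

Lemma ordS_ind (P : 'I_n -> Prop) : P ord0 -> (forall i, P i -> P (ordS i)) -> forall i, P i.
Proof.
move=> P0 PS [k lt_kn]; elim: k lt_kn => [|k IHk] lt_kn.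
  by rewrite (_ : Ordinal _ = ord0) //; apply: val_inj.
have lt_k : (k < n)%N by apply: ltnW.
rewrite (_ : Ordinal _ = ordS (Ordinal lt_k)); first exact: PS.
by apply: val_inj; rewrite /= modn_small.
Qed.

Lemma fwd_subproof i : @adj W (Some i, Some (ordS i)).1 (Some i, Some (ordS i)).2.
Proof. by apply/andP; split; [apply: ordS_neq | apply/orP; left]. Qed.

Lemma bwd_subproof i : @adj W (Some i, Some (ord_pred i)).1 (Some i, Some (ord_pred i)).2.
Proof.
apply/andP; split; last by apply/orP; right; rewrite ord_predK.
by have := ordS_neq (ord_pred i); rewrite ord_predK eq_sym.
Qed.

(** The two darts of the spoke at the rim vertex i: [hub i] leaves the hub and
    [spoke i] leaves the rim. *)
Definition hub i : dartW := exist _ (None, Some i) isT.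
Definition spoke i : dartW := exist _ (Some i, None) isT.
Definition fwd i : dartW := exist _ (Some i, Some (ordS i)) (fwd_subproof i).
Definition bwd i : dartW := exist _ (Some i, Some (ord_pred i)) (bwd_subproof i).

Lemma dartW_ind (P : dartW -> Prop) :
    (forall i, P (hub i)) -> (forall i, P (spoke i)) ->
    (forall i, P (fwd i)) -> (forall i, P (bwd i)) ->
  forall d, P d.
Proof.
move=> Ph Ps Pf Pb [[[i|] [j|]] adj_ij] //.
- have /= /andP[_ /orP[/eqP eq_j|/eqP eq_i]] := adj_ij.
    by rewrite (_ : exist _ _ _ = fwd i) //; apply: val_inj; rewrite /= eq_j.
  rewrite (_ : exist _ _ _ = bwd i) //; apply: val_inj.
  by rewrite /= eq_i ordSK.
- by rewrite (_ : exist _ _ _ = spoke i) //; apply: val_inj.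
- by rewrite (_ : exist _ _ _ = hub j) //; apply: val_inj.
Qed.

Lemma hub_inj : injective hub. Proof. by move=> i j [->]. Qed.

Lemma dart_eqE : ((forall i j, (hub i == hub j) = (i == j)) *
  (forall i j, (hub i == spoke j) = false) * (forall i j, (spoke j == hub i) = false) *
  (forall i j, (hub i == fwd j) = false) * (forall i j, (fwd j == hub i) = false) *
  (forall i j, (hub i == bwd j) = false) * (forall i j, (bwd j == hub i) = false) *
  (forall i j, (spoke i == spoke j) = (i == j)) *
  (forall i j, (spoke i == fwd j) = false) * (forall i j, (fwd j == spoke i) = false) *
  (forall i j, (spoke i == bwd j) = false) * (forall i j, (bwd j == spoke i) = false) *
  (forall i j, (fwd i == bwd j) = false) * (forall i j, (bwd j == fwd i) = false) *
  (forall i j, (fwd i == fwd j) = (i == j)) * (forall i j, (bwd i == bwd j) = (i == j)))%type.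
Proof.
have fb i j : fwd i == bwd j = false.
  apply/eqP=> eq_fb; have /Some_inj eq_ij := congr1 (fun d => (val d).1) eq_fb.
  have /Some_inj/eqP := congr1 (fun d => (val d).2) eq_fb.
  by rewrite eq_ij (negbTE (ordS_ord_pred_neq j)).
repeat split=> //; move=> i j; rewrite ?fb //; try by rewrite eq_sym fb.
all: try by rewrite -val_eqE /= xpair_eqE /= andbF.
all: by apply/eqP/eqP => [/(congr1 (fun d => (val d).1)) [] | ->].
Qed.

Lemma drevE : ((forall i, drev (hub i) = spoke i) * (forall i, drev (spoke i) = hub i) *
  (forall i, drev (fwd i) = bwd (ordS i)) * (forall i, drev (bwd i) = fwd (ord_pred i)))%type.
Proof.
by do !split; move=> i; apply: val_inj; rewrite //= ?ordSK ?ord_predK.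
Qed.

(** The rotation at the rim vertex i is (spoke, fwd, bwd) if i is in S and the
    opposite one otherwise; the darts at the hub are fixed. *)
Definition rim_step S d : dartW :=
  match val d with
  | (Some i, Some j) => if j == ordS i then (if i \in S then bwd i else spoke i)
                        else if i \in S then spoke i else fwd i
  | (Some i, None) => if i \in S then fwd i else bwd i
  | _ => d
  end.

Lemma rim_stepE S : ((forall i, rim_step S (hub i) = hub i) *
  (forall i, rim_step S (spoke i) = if i \in S then fwd i else bwd i) *
  (forall i, rim_step S (fwd i) = if i \in S then bwd i else spoke i) *
  (forall i, rim_step S (bwd i) = if i \in S then spoke i else fwd i))%type.
Proof.
do !split=> //; move=> i; rewrite /rim_step /= ?eqxx //.
by rewrite eq_sym (negbTE (ordS_ord_pred_neq i)).
Qed.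

Lemma rim_stepK S : cancel (rim_step S) (rim_step (~: S)).
Proof.
by elim/dartW_ind=> i; rewrite !rim_stepE //; case: ifP => iS; rewrite rim_stepE inE iS.
Qed.

Definition rim_rotation S : {perm dartW} := perm (can_inj (rim_stepK S)).

Lemma rim_rotationE S d : rim_rotation S d = rim_step S d.
Proof. exact: permE. Qed.

Definition hubs : {set dartW} := [set hub i | i : 'I_n].

Lemma mem_hubs : ((forall i, (hub i \in hubs) = true) * (forall i, (spoke i \in hubs) = false) *
  (forall i, (fwd i \in hubs) = false) * (forall i, (bwd i \in hubs) = false))%type.
Proof.
by do !split; move=> i; rewrite ?imset_f //; apply/imsetP=> -[j _ /eqP]; rewrite dart_eqE.
Qed.

Lemma card_hubs : #|hubs| = n.
Proof. by rewrite card_imset ?card_ord //; apply: hub_inj. Qed.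

Definition spin rho : {set 'I_n} := [set i | rho (spoke i) == fwd i].

Lemma tail_hub i : [set d | tail d == tail (hub i)] = hubs.
Proof. by apply/setP; elim/dartW_ind=> j; rewrite mem_hubs inE. Qed.

Lemma tail_rim i : [set d : dartW | tail d == Some i] = [set d in [:: spoke i; fwd i; bwd i]].
Proof.
by apply/setP; elim/dartW_ind=> j; rewrite !inE !dart_eqE ?orbF.
Qed.

Lemma rotation_system_rim rho : is_rotation_system rho ->
  forall d, d \notin hubs -> rho d = rim_step (spin rho) d.
Proof.
move=> /forallP rot_rho.
have orb i d : tail d = Some i -> porbit rho d = [set d in [:: spoke i; fwd i; bwd i]].
  by move=> tl; rewrite (eqP (rot_rho d)) tl tail_rim.
have rimE i : [/\ rho (spoke i) = rim_step (spin rho) (spoke i),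
   rho (fwd i) = rim_step (spin rho) (fwd i) & rho (bwd i) = rim_step (spin rho) (bwd i)].
  rewrite !rim_stepE inE; case: eqP => [eq_f|/eqP neq_f].
    have [] := @porbit3 _ rho (spoke i) (bwd i) (fwd i).
    - by rewrite /= !inE !dart_eqE.
    - by rewrite (orb i) //; apply/setP=> d; rewrite !inE; congr (_ || _); rewrite orbC.
    - by rewrite eq_f dart_eqE.
    by split.
  have [] := @porbit3 _ rho (spoke i) (fwd i) (bwd i); rewrite ?(orb i) //=.
    by rewrite !inE !dart_eqE.
by elim/dartW_ind=> i; rewrite mem_hubs //; case: (rimE i).
Qed.

(** Rotation systems correspond to pairs of a set S of rim vertices, which fixes
    the rotations on the rim, and a cyclic permutation u of the darts at the
    hub. *)
Lemma rotation_system_spin S u :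
  is_rotation_system (rim_rotation S * u)%g && (spin (rim_rotation S * u)%g == S) =
  (u \in cyclic_on hubs).
Proof.
rewrite (cyclic_on_porbit _ (_ : hub ord0 \in hubs)) ?mem_hubs //.
set rho := (rim_rotation S * u)%g.
have rhoE d : rho d = u (rim_step S d) by rewrite permM rim_rotationE.
have rho_hub i : rho (hub i) = u (hub i) by rewrite rhoE rim_stepE.
have stepN d : (rim_step S d \in hubs) = (d \in hubs).
  by elim/dartW_ind: d => i; rewrite rim_stepE //; case: ifP; rewrite !mem_hubs.
apply/andP/andP=> -[].
  move=> rot_rho /eqP spin_rho; have uN d : d \notin hubs -> u d = d.
    move=> nd; have := rotation_system_rim rot_rho (d := rim_step (~: S) d).
    rewrite spin_rho rhoE -[X in rim_step X (rim_step (~: S) d)]setCK rim_stepK.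
    apply; rewrite -(setCK S) in stepN.
    by rewrite -stepN rim_stepK.
  have uA : perm_on hubs u by apply/subsetP=> d; rewrite inE; apply: contraR => /uN->.
  split=> //; apply/forall_inP=> _ /imsetP[i _ ->].
  rewrite -(tail_hub i) -(eqP (forallP rot_rho (hub i))).
  apply/eqP/esym/(@eq_porbit_in _ _ _ hubs) => [|_ /imsetP[j _ ->]|d hd] //;
    rewrite ?mem_hubs //.
  by rewrite perm_closed.
move=> uA /forall_inP orb_u.
have rho_rim d : d \notin hubs -> rho d = rim_step S d.
  by move=> nd; rewrite rhoE (out_perm uA) // stepN.
split; last first.
  apply/eqP/setP=> i; rewrite inE rho_rim ?mem_hubs // rim_stepE.
  by case: ifP; rewrite !dart_eqE ?eqxx.
have orb_rim i d : tail d = Some i -> porbit rho d == [set d' | tail d' == tail d].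
  move=> tl; rewrite tl tail_rim; apply/eqP.
  pose c := if i \in S then [:: spoke i; fwd i; bwd i] else [:: spoke i; bwd i; fwd i].
  have c_set : [set d' in c] = [set d' in [:: spoke i; fwd i; bwd i]].
    rewrite /c; case: ifP => _ //; apply/setP=> d'.
    by rewrite !inE; congr (_ || _); rewrite orbC.
  have cyc : fcycle rho c.
    by rewrite /c; case: ifP => iS; rewrite /= !rho_rim ?mem_hubs // !rim_stepE iS !eqxx.
  have c_d : d \in c.
    have : d \in [set d' in c] by rewrite c_set -tail_rim inE tl.
    by rewrite inE.
  by rewrite (porbit_fcycle cyc c_d) c_set.
apply/forallP; elim/dartW_ind=> i; try exact: (@orb_rim i).
rewrite tail_hub -(eqP (orb_u (hub i) _)) ?mem_hubs //.
apply/eqP/(@eq_porbit_in _ _ _ hubs) => [|_ /imsetP[j _ ->]|d hd] //;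
  rewrite ?mem_hubs //.
by rewrite perm_closed.
Qed.

(** Face tracing with the trivial rotation at the hub: a walk that reaches the
    hub turns back along the same spoke. Thus the two cycles of this
    permutation are the two sides of the rim, with the spokes attached
    on each of them. *)
Definition rim_face S : {perm dartW} := (drev_perm W * rim_rotation S)%g.

Lemma face_count_split S u :
  face_count (rim_rotation S * u)%g = #|porbits (u * rim_face S)%g|.
Proof. by rewrite /face_count /face_perm mulgA card_porbits_mulC. Qed.

Lemma rim_faceE S : ((forall i, rim_face S (hub i) = if i \in S then fwd i else bwd i) *
  (forall i, rim_face S (spoke i) = hub i) *
  (forall i, rim_face S (fwd i) = if ordS i \in S then spoke (ordS i) else fwd (ordS i)) *
  (forall i, rim_face S (bwd i) =
     if ord_pred i \in S then bwd (ord_pred i) else spoke (ord_pred i)))%type.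
Proof. by do !split; move=> i; rewrite permM rim_rotationE permE drevE rim_stepE. Qed.

(** The side of the rim on which a dart lies; the spokes of S are on the side
    traversed forwards. *)
Definition side S d : bool :=
  match val d with
  | (None, Some i) | (Some i, None) => i \in S
  | (Some i, Some j) => j == ordS i
  | _ => false
  end.

Lemma sideE S : ((forall i, side S (hub i) = (i \in S)) *
  (forall i, side S (spoke i) = (i \in S)) *
  (forall i, side S (fwd i) = true) * (forall i, side S (bwd i) = false))%type.
Proof.
do !split; move=> i; rewrite /side //= ?eqxx //.
by rewrite eq_sym (negbTE (ordS_ord_pred_neq i)).
Qed.

Lemma side_face S d : side S (rim_face S d) = side S d.
Proof.
by elim/dartW_ind: d => i; rewrite rim_faceE; try case: ifP; rewrite !sideE // => ->.
Qed.

(** Each forward dart leads to the next one, directly or through the spoke in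
    between, and a backward dart to the previous one. *)
Lemma fconnect_side S (b : bool) d : side S d = b ->
  fconnect (rim_face S) (if b then fwd ord0 else bwd ord0) d.
Proof.
set f := rim_face S; have fsym := fconnect_sym (@perm_inj _ f).
have step y : fconnect f y (f y) by apply: fconnect1.
have spoke_hub i : fconnect f (spoke i) (hub i) by have := step (spoke i); rewrite rim_faceE.
have fwdC i : fconnect f (fwd ord0) (fwd i).
  elim/ordS_ind: i => [|i IHi]; first exact: connect0.
  apply: connect_trans IHi _; have := step (fwd i); rewrite rim_faceE.
  case: ifP => // iS c1; apply: connect_trans c1 (connect_trans (spoke_hub _) _).
  by have := step (hub (ordS i)); rewrite rim_faceE iS.
have bwdC i : fconnect f (bwd ord0) (bwd i).
  elim/ordS_ind: i => [|i IHi]; first exact: connect0.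
  apply: connect_trans IHi _; rewrite fsym; have := step (bwd (ordS i)).
  rewrite rim_faceE ordSK; case: ifP => // iS c1.
  apply: connect_trans c1 (connect_trans (spoke_hub _) _).
  by have := step (hub i); rewrite rim_faceE iS.
have hubC i : fconnect f (if i \in S then fwd ord0 else bwd ord0) (hub i).
  have := step (hub i); rewrite rim_faceE fsym; case: ifP => iS; apply: connect_trans.
    exact: fwdC.
  exact: bwdC.
elim/dartW_ind: d => i; rewrite sideE => <- //.
by apply: connect_trans (hubC i) _; rewrite fsym.
Qed.

Definition rim_cycles S :=
  [:: fingraph.orbit (rim_face S) (fwd ord0); fingraph.orbit (rim_face S) (bwd ord0)].

Lemma mem_rim_orbit S (b : bool) d :
  (d \in fingraph.orbit (rim_face S) (if b then fwd ord0 else bwd ord0)) = (side S d == b).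
Proof.
rewrite -fconnect_orbit; apply/idP/eqP => [|]; last exact: fconnect_side.
move=> /iter_findex <-; elim: (findex _ _ _) => [|k IHk] /=; last by rewrite side_face.
by case: b; rewrite sideE.
Qed.

Lemma rim_cycles_decomposition S : cycle_decomposition (rim_face S) (rim_cycles S).
Proof.
have injf := @perm_inj _ (rim_face S).
split; last by rewrite /= !cycle_orbit.
  rewrite /= cats0; apply: uniq_perm => [||d]; rewrite ?enum_uniq //.
    rewrite cat_uniq !orbit_uniq andbT; apply/hasPn => d.
    by rewrite (mem_rim_orbit S false) (mem_rim_orbit S true) => /eqP->.
  rewrite mem_enum mem_cat (mem_rim_orbit S false) (mem_rim_orbit S true).
  by case: (side S d).
rewrite !inE negb_or; apply/andP; split; apply/eqP => /(congr1 size)/eqP;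
  by rewrite size_orbit /= ltn_eqF ?order_gt0.
Qed.

Lemma count_rim_orbit S (b : bool) :
  count (mem hubs) (fingraph.orbit (rim_face S) (if b then fwd ord0 else bwd ord0)) =
  if b then #|S| else (n - #|S|)%N.
Proof.
have -> : (if b then #|S| else (n - #|S|)%N) = #|[set i | (i \in S) == b]|.
  case: b; first by apply: eq_card => i; rewrite inE eqb_id.
  rewrite -[X in (X - _)%N](card_ord n) -(cardsC S) addKn; apply: eq_card => i.
  by rewrite !inE eqbF_neg.
rewrite -(card_imset _ hub_inj) -size_filter -(card_uniqP _) ?filter_uniq ?orbit_uniq //.
apply: eq_card => d; rewrite mem_filter mem_rim_orbit.
apply/andP/imsetP => [[/imsetP[i _ ->]]|[i + ->]].
  by rewrite sideE; exists i; rewrite ?inE.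
by rewrite inE sideE => iS; split=> //; apply: imset_f.
Qed.

Lemma count_rim_cycles S :
  map (count (mem hubs)) (rim_cycles S) = [:: #|S|; (n - #|S|)%N].
Proof. by rewrite /= (count_rim_orbit S true) (count_rim_orbit S false). Qed.

Lemma card_wheel : #|W| = n.+1.
Proof. by rewrite card_option card_ord. Qed.

Lemma card_edges_wheel : #|edges W| = n.*2.
Proof.
pose rim_edge i : {set W} := [set Some i; Some (ordS i)].
pose spoke_edge i : {set W} := [set None; Some i].
have rim_inj : injective rim_edge.
  move=> i j /setP eq_ij; have := eq_ij (Some i); have := eq_ij (Some (ordS i)).
  rewrite !inE !eqxx orbT /= => /esym/orP[/eqP/Some_inj eqS|/eqP/Some_inj/ordS_inj //].
  case/esym/orP=> /eqP/Some_inj // eq_i.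
  by have := ordS_ord_pred_neq i; rewrite eqS eq_i ordSK eqxx.
have spoke_inj : injective spoke_edge.
  by move=> i j /setP/(_ (Some i)); rewrite !inE eqxx /= => /esym/eqP/Some_inj.
have -> : edges W = rim_edge @: setT :|: spoke_edge @: setT.
  apply/setP=> e; apply/imsetP/setUP => [[p adj_p ->]|[]/imsetP[i _ ->]].
  - have : forall d, [set (val d).1; (val d).2] \in rim_edge @: setT :|: spoke_edge @: setT.
      elim/dartW_ind=> i; rewrite inE.
      + by rewrite [X in _ || X]imset_f ?orbT.
      + by rewrite setUC [X in _ || X]imset_f ?orbT.
      + by rewrite [X in X || _]imset_f.
      by rewrite setUC -{2}(ord_predK i) [X in X || _]imset_f.
    by move=> /(_ (exist _ p adj_p)) /setUP.
  - by exists (val (fwd i)) => //; apply: (valP (fwd i)).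
  - by exists (val (hub i)).
rewrite cardsU !card_imset // cardsT card_ord (_ : _ :&: _ = set0) ?cards0 ?subn0 ?addnn //.
apply/setP=> e; rewrite !inE; apply/andP=> -[/imsetP[i _ ->] /imsetP[j _ /setP/(_ None)]].
by rewrite !inE.
Qed.

Lemma rotation_system_split rho : is_rotation_system rho ->
  exists S u, u \in cyclic_on hubs /\ rho = (rim_rotation S * u)%g.
Proof.
move=> rot_rho; exists (spin rho), ((rim_rotation (spin rho))^-1 * rho)%g.
by rewrite -(rotation_system_spin (spin rho)) mulKVg rot_rho eqxx.
Qed.

Lemma hubs_neq0 : hubs != set0.
Proof. by rewrite -card_gt0 card_hubs. Qed.

Definition genus rho : nat := (n.+1 - face_count rho)./2.

Lemma face_count_genus rho : is_rotation_system rho ->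
  (face_count rho + (genus rho).*2 = n.+1)%N.
Proof.
case/rotation_system_split=> S [u [uA ->]].
have [k] := card_porbits_cyclic_mul (rim_face S) hubs_neq0 uA.
rewrite (card_porbits (rim_cycles_decomposition S)) card_hubs -face_count_split.
by rewrite /genus; move: (face_count _) => f; rewrite /= /n; lia.
Qed.

Lemma genus_dist_wheel k :
  genus_dist W k = #|[set rho | is_rotation_system rho & genus rho == k]|.
Proof.
apply: eq_card => rho; rewrite !inE; apply: andb_id2l => /face_count_genus.
rewrite card_wheel card_edges_wheel; move: (genus rho) (face_count rho) => g f.
by rewrite /n => fg; apply/eqP/eqP; lia.
Qed.

(** When all spokes lie on the same side of the rim, the greedy choice of the
    rotation at the hub yields n + 1 faces: the planar embedding. *)
Lemma genus_dist0_gt0 : (0 < genus_dist W 0)%N.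
Proof.
have [|u uA card_u] := cyclic_on_max (rim_cycles_decomposition [set: 'I_n]) hubs_neq0.
  by move=> _ /imsetP[i _ ->]; rewrite (mem_rim_orbit setT true) sideE inE.
rewrite genus_dist_wheel card_gt0; apply/set0Pn; exists (rim_rotation setT * u)%g.
move: uA; rewrite -(rotation_system_spin setT) => /andP[rot_rho _].
rewrite inE rot_rho /genus face_count_split.
move: card_u; rewrite (card_porbits (rim_cycles_decomposition _)) card_hubs /= => card_u.
by apply/eqP; move: card_u; move: #|_| => f; rewrite /n; lia.
Qed.

Local Open Scope ring_scope.

Definition face_poly (R : numDomainType) (x : R) : R :=
  \sum_(rho | is_rotation_system (rho : {perm dartW})) x ^+ face_count rho.

Lemma face_poly_sum (R : numDomainType) (x : R) :
  face_poly x = \sum_S face_sum x hubs (rim_face S).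
Proof.
rewrite /face_poly (partition_big spin predT) //=; apply: eq_bigr => S _.
rewrite (reindex_inj (mulgI (rim_rotation S))) /=; apply: eq_big => [u|u _].
  exact: rotation_system_spin.
by rewrite face_count_split.
Qed.

(** The polynomial g such that n (n + 1) F(x) is g(E) applied to
    x (x + 1) ... (x + n), where E is the backward shift and F(x) is the
    generating function of the face numbers. *)
Definition wheel_symbol (R : comNzRingType) (x : R) : {poly R} :=
  \sum_(S : {set 'I_n}) (1 - 'X^(#|S|)) * (1 - 'X^(n - #|S|)) + (2 * x) *: (1 - 'X^n).

(** When all spokes lie on one side, the other side of the rim is a face by
    itself: the product on the right vanishes, and the correction is the
    contribution of this face. *)
Lemma stanley_wheel (R : comNzRingType) (x : R) S :
  stanley x [:: #|S|; (n - #|S|)%N] =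
  umbral (rising n.+1) x ((1 - 'X^(#|S|)) * (1 - 'X^(n - #|S|))) +
  (if S \in [set set0; setT] then x * umbral (rising n.+1) x (1 - 'X^n) else 0).
Proof.
have leS : (#|S| <= n)%N by rewrite -[leqRHS](card_ord n) max_card.
have S0 : (S == set0) = (#|S| == 0)%N by rewrite cards_eq0.
have ST : (S == setT) = (n - #|S| == 0)%N.
  by rewrite eqEcard subsetT /= cardsT card_ord subn_eq0.
rewrite !inE S0 ST /stanley /= !addn0 subnKC //.
have [Sz|Spos] := posnP #|S|.
  rewrite Sz subn0 /= expr0 subrr mul0r linear0 add0r.
  by rewrite cycle_poly_cons0 cycle_poly_cons // /cycle_poly big_nil mulr1.
have [Cz|Cpos] := posnP (n - #|S|).
  have eqS : #|S| = n by apply/eqP; rewrite eqn_leq leS -subn_eq0 Cz.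
  rewrite Cz eqS /= expr0 subrr mulr0 linear0 add0r.
  by rewrite cycle_poly_cons // cycle_poly_cons0 /cycle_poly big_nil mulr1.
rewrite /= addr0 [x ^+ _]expr0 mul1r !cycle_poly_cons // /cycle_poly big_nil mulr1.
by [].
Qed.

Lemma face_poly_umbral (R : numDomainType) (x : R) :
  (n * n.+1)%:R * face_poly x = umbral (rising n.+1) x (wheel_symbol x).
Proof.
rewrite face_poly_sum mulr_sumr /wheel_symbol linearD linear_sum linearZ /=.
have sumE S := stanley_formula x (rim_cycles_decomposition S) hubs_neq0.
rewrite card_hubs in sumE; rewrite (eq_bigr _ (fun S _ => sumE S)).
under eq_bigr do rewrite count_rim_cycles stanley_wheel.
rewrite big_split /=; congr (_ + _); rewrite -big_mkcond sumr_const cards2.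
rewrite (_ : set0 != setT); first by rewrite -mulrA mulr_natl.
by rewrite eq_sym -card_gt0 cardsT card_ord.
Qed.

Lemma face_poly_neq0 (C : numClosedFieldType) (x : C) : 0 < 'Re x -> face_poly x != 0.
Proof.
move=> x0; have leS S : (#|S| <= n)%N by rewrite -[leqRHS](card_ord n) max_card.
suff : (n * n.+1)%:R * face_poly x != 0 by rewrite mulf_eq0 negb_or => /andP[].
have size_1X k : (size ((1 - 'X^k)%R : {poly C}) <= k.+1)%N.
  by rewrite (leq_trans (size_polyD _ _)) // geq_max size_poly1 size_polyN size_polyXn leqnn.
rewrite face_poly_umbral umbral_rising_neq0 // => [|t t1].
  rewrite (leq_trans (size_polyD _ _)) // geq_max; apply/andP; split.
    rewrite (leq_trans (size_sum _ _ _)) //; apply/bigmax_leqP => S _.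
    rewrite (leq_trans (size_polyMleq _ _)) //.
    have := size_1X #|S|; have := size_1X (n - #|S|)%N; have := leS S.
    by move: (size _) (size _) => a b; lia.
  by rewrite (leq_trans (size_scale_leq _ _)).
rewrite rootE /wheel_symbol hornerD hornerZ horner_sum.
under eq_bigr do rewrite !hornerE.
rewrite !hornerE.
exact: (@sum_mobius_neq0 C {set 'I_n} (fun S => #|S|)).
Qed.

Lemma horner_genus_poly (R : numDomainType) (y : R) :
  (map_poly intr (genus_poly W)).[y] =
  \sum_(rho | is_rotation_system (rho : {perm dartW})) y ^+ genus rho.
Proof.
rewrite (@horner_coef_wide _ (n.*2.+2)); last first.
  by rewrite (leq_trans (size_poly _ _)) // (leq_trans (size_poly _ _)) // card_edges_wheel.
pose F k (rho : {perm dartW}) : R := if genus rho == k then y ^+ k else 0.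
transitivity (\sum_(k < n.*2.+2) \sum_(rho : {perm dartW} | is_rotation_system rho) F k rho).
  apply: eq_bigr => k _; rewrite coef_map coef_genus_poly /= genus_dist_wheel.
  rewrite -big_mkcondr /= sumr_const mulr_natl; congr (_ *+ _).
  by apply: eq_card => rho; rewrite !inE.
rewrite exchange_big /=; apply: eq_bigr => rho rot_rho.
have lt_g : (genus rho < n.*2.+2)%N by have := face_count_genus rot_rho; lia.
rewrite (bigD1 (Ordinal lt_g)) //= /F eqxx big1 ?addr0 // => k.
by rewrite -val_eqE /= eq_sym => /negbTE->.
Qed.

(** By Euler's formula, genus k means n + 1 - 2 k faces. *)
Lemma face_poly_genus_poly (F : numFieldType) (x : F) : x != 0 ->
  face_poly x = x ^+ n.+1 * (map_poly intr (genus_poly W)).[x ^- 2].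
Proof.
move=> x0; rewrite horner_genus_poly mulr_sumr; apply: eq_bigr => rho rot_rho.
rewrite -(face_count_genus rot_rho) exprD -mulrA -[in LHS](mulr1 (x ^+ _)); congr (_ * _).
by rewrite exprVn -exprM mul2n mulfV // expf_neq0.
Qed.

End Wheel.

(** * Log-concave sequences *)

Section LogConcave.
Local Open Scope ring_scope.
Variable R : numDomainType.

(** For i = j this is log-concavity; allowing i < j excludes internal zeros in
    effect, and makes the property stable under products with X - z. *)
Definition log_concave_poly (p : {poly R}) : Prop :=
  (forall i, 0 <= p`_i) /\
  (forall i j, (i <= j)%N -> p`_i * p`_j.+2 <= p`_i.+1 * p`_j.+1).

Lemma log_concave_prod_XsubC (zs : seq R) :
  {in zs, forall z, z < 0} -> log_concave_poly (\prod_(z <- zs) ('X - z%:P)).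
Proof.
elim: zs => [|z zs IHzs] neg.
  rewrite big_nil; split=> [i|i j _]; rewrite !coef1 ?ler0n //.
  by rewrite mulr0 mulr_ge0 ?ler0n.
rewrite big_cons; set p := \prod_(_ <- _) _ in IHzs *.
have [p0 lcp] := IHzs (fun y zsy => neg y (mem_behead (s := z :: zs) zsy)).
have r0 : 0 <= - z by rewrite oppr_ge0 ltW ?neg ?mem_head.
have c0 : (('X - z%:P) * p)`_0 = - z * p`_0.
  by rewrite mulrBl coefB coefXM coefCM /= sub0r mulNr.
have cS i : (('X - z%:P) * p)`_i.+1 = p`_i + - z * p`_i.+1.
  by rewrite mulrBl coefB coefXM coefCM /= mulNr.
split=> [[|i]|]; rewrite ?c0 ?cS ?addr_ge0 ?mulr_ge0 //.
case=> [|i] j le_ij; rewrite ?c0 !cS.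
  rewrite -subr_ge0.
  have -> : (p`_0 + - z * p`_1) * (p`_j + - z * p`_j.+1) -
            - z * p`_0 * (p`_j.+1 + - z * p`_j.+2) =
     p`_0 * p`_j + - z * (p`_1 * p`_j) +
     - z * - z * (p`_1 * p`_j.+1 - p`_0 * p`_j.+2) by ring.
  by rewrite !addr_ge0 ?mulr_ge0 // subr_ge0 lcp.
case: j le_ij => // j le_ij.
rewrite -subr_ge0.
have -> : (p`_i.+1 + - z * p`_i.+2) * (p`_j.+1 + - z * p`_j.+2) -
          (p`_i + - z * p`_i.+1) * (p`_j.+2 + - z * p`_j.+3) =
  (p`_i.+1 * p`_j.+1 - p`_i * p`_j.+2) +
  - z * (p`_i.+2 * p`_j.+1 - p`_i * p`_j.+3) +
  - z * - z * (p`_i.+2 * p`_j.+2 - p`_i.+1 * p`_j.+3) by ring.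
apply: addr_ge0; last by rewrite !mulr_ge0 ?subr_ge0 ?lcp.
apply: addr_ge0; first by rewrite subr_ge0 lcp.
rewrite mulr_ge0 // subr_ge0.
apply: le_trans (lcp i j.+1 _) _; first exact: ltnW.
move: le_ij; rewrite ltnS leq_eqVlt => /predU1P[->|lt_ij]; first by rewrite mulrC.
exact: lcp.
Qed.

Lemma log_concave_scale (c : R) p :
  0 <= c -> log_concave_poly p -> log_concave_poly (c *: p).
Proof.
move=> c0 [p0 lcp]; split=> [i|i j le_ij]; rewrite !coefZ ?mulr_ge0 //.
by rewrite mulrACA [leRHS]mulrACA ler_wpM2l ?mulr_ge0 ?lcp.
Qed.

End LogConcave.

Section LogConcaveNat.
Variable a : nat -> nat.
Hypothesis lca : forall i j, (i <= j -> a i * a j.+2 <= a i.+1 * a j.+1)%N.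

Lemma strong_log_concave N : log_concave N a.
Proof. by case=> [|k] // _; rewrite -mulnn lca. Qed.

(** Once the sequence has decreased strictly, the inequalities with i fixed at
    that place prevent any later increase. *)
Lemma strong_log_concave_unimodal N : unimodal N a.
Proof.
have desc k l : (k <= l -> a k.+1 < a k -> a l.+1 <= a l)%N.
  rewrite leq_eqVlt => /predU1P[->|lt_kl]; first exact: ltnW.
  case: l lt_kl => // l le_kl lt_a; rewrite leqNgt; apply/negP=> lt_al.
  have := @lca k l le_kl; rewrite leqNgt => /negP; apply.
  by rewrite ltn_mul.
have exP : exists j, (N <= j)%N || (a j.+1 < a j)%N by exists N; rewrite leqnn.
case: (ex_minnP exP) => j Pj min_j; exists j.
  by rewrite min_j ?leqnn.
split=> [k lt_kj|k /andP[le_jk lt_kN]].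
  by rewrite leqNgt; apply: contraL lt_kj => ak; rewrite -leqNgt min_j // ak orbT.
case/orP: Pj => [le_Nj|]; last exact: desc.
by move: (leq_ltn_trans le_jk lt_kN); rewrite ltnNge le_Nj.
Qed.

End LogConcaveNat.

(** * The genus polynomial of the wheel *)

Section RealRoots.
Local Open Scope ring_scope.

(** Neither square root of 1/z can have positive real part, as it would be a
    zero of the generating function of the face numbers; they are opposite,
    so both are imaginary and z is negative. *)
Lemma genus_poly_wheel_root (n : nat) (C : numClosedFieldType) (z : C) : (3 <= n)%N ->
  root (map_poly intr (genus_poly (wheel n))) z -> z < 0.
Proof.
case: n => [|[|[|m]]] // _ /rootP Gz.
have z0 : z != 0.
  apply: contra_eqN Gz => /eqP->; rewrite horner_coef0 coef_map coef_genus_poly /=.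
  by rewrite pnatr_eq0 -lt0n genus_dist0_gt0.
have Re_le0 (x : C) : x ^- 2 = z -> 'Re x <= 0.
  move=> xz; rewrite real_leNgt ?Creal_Re ?rpred0 //.
  apply/negP=> /(face_poly_neq0 m)/eqP; apply.
  rewrite face_poly_genus_poly ?xz ?Gz ?mulr0 //.
  by apply: contraNneq z0 => x0; rewrite -xz x0 expr0n invr0.
pose x := sqrtC z^-1.
have xz : x ^- 2 = z by rewrite sqrtCK invrK.
have Rex : 'Re x = 0.
  apply/eqP; rewrite eq_le Re_le0 //= -oppr_le0 -raddfN Re_le0 //.
  by rewrite sqrrN.
have xE : x ^+ 2 = - 'Im x ^+ 2.
  by rewrite {1}[x]Crect Rex add0r exprMn sqrCi mulN1r.
have z_le0 : z <= 0.
  by rewrite -xz xE invrN oppr_le0 invr_ge0 real_exprn_even_ge0 // Creal_Im.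
by rewrite lt_neqAle z0.
Qed.

Lemma genus_dist_wheel_log_concave (n : nat) : (3 <= n)%N -> forall i j, (i <= j)%N ->
  (genus_dist (wheel n) i * genus_dist (wheel n) j.+2 <=
   genus_dist (wheel n) i.+1 * genus_dist (wheel n) j.+1)%N.
Proof.
move=> hn i j le_ij; pose p : {poly algC} := map_poly intr (genus_poly (wheel n)).
have pE k : p`_k = (genus_dist (wheel n) k)%:R by rewrite coef_map coef_genus_poly.
suff [_ /(_ i j le_ij)] : log_concave_poly p by rewrite !pE -!natrM ler_nat.
have [zs defp] := closed_field_poly_normal p.
rewrite defp; apply: log_concave_scale; first by rewrite lead_coefE pE ler0n.
apply: log_concave_prod_XsubC => z zs_z; apply: (genus_poly_wheel_root hn).
rewrite -/p defp.
have [p0|p0] := eqVneq (lead_coef p) 0; first by rewrite p0 scale0r root0.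
by rewrite rootZ // root_prod_XsubC.
Qed.

End RealRoots.

Theorem theorem1p6 (n : nat) (hn : (3 <= n)%N) :
  (forall (C : numClosedFieldType) (z : C),
     root (map_poly intr (genus_poly (wheel n))) z ->
     (z \is Num.real) /\ (z < 0)%R) /\
  (forall N : nat, log_concave N (genus_dist (wheel n))
                   /\ unimodal N (genus_dist (wheel n))).
Proof.
split=> [C z /(genus_poly_wheel_root hn) z_lt0|N].
  by split=> //; rewrite ltr0_real.
have lc := genus_dist_wheel_log_concave hn.
by split; [apply: strong_log_concave | apply: strong_log_concave_unimodal].
Qed.
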